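(* Let $0 \le \alpha < 1$, let $f = h + \overline{g} \in \mathcal{F}(\alpha)$ with $h(z) = z + \sum_{k=2}^\infty a_k z^k$, $g(z) = \sum_{k=1}^\infty b_k z^k$, and let $n, m \ge 2$ be integers. For $r \in (0,1)$ define $$\psi(n,m,r,\alpha) = A(r,\alpha) - \sum_{k=n+1}^\infty k A_k(\alpha) r^{k-1} - \sum_{k=m+1}^\infty \frac{k(k-1)}{k-2\alpha} A_k(\alpha) r^{k-1},$$ where $A(r,\alpha) = \frac{1-r^2}{r^2} L(r,\alpha)^2$ and $A_k(\alpha) = \frac{1}{k!}\prod_{j=2}^k (j-2\alpha)$. Let $r_{n,m}$ be the smallest zero of $r \mapsto \psi(n,m,r,\alpha)$ in $(0,1)$. Then for every $\theta \in \mathbb{R}$ the harmonic polynomial $$s_{n,m}(f;\theta)(z) = \sum_{k=1}^n a_k z^k + e^{i\theta}\,\overline{\sum_{k=1}^m b_k z^k} \qquad (a_1 = 1)$$ is univalent in the disk $|z| < r_{n,m}$. Moreover, when $\alpha = 1/2$, $r_{n,m} \ge 1 - \frac{2\log l}{l}$, where $l = \min\{n,m\} \ge 3$.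
   Context: $\mathbb{D} = \{z \in \mathbb{C} : |z| < 1\}$. For $\alpha \ge -1/2$, $\mathcal{F}(\alpha)$ denotes the set of complex-valued harmonic functions $f = h + \overline{g}$ on $\mathbb{D}$, with $h, g$ analytic in $\mathbb{D}$ normalized by $h(0) = g(0) = 0$, $h'(0) = 1$, such that $\operatorname{Re}\left(1 + \frac{z h''(z)}{h'(z)}\right) > \alpha$ for all $z \in \mathbb{D}$ and, for some real constant $\theta$, $g'(z) = e^{i\theta} z h'(z)$ for all $z \in \mathbb{D}$. Here $L(r,\alpha)$ equals $\frac{2r}{1+r} - \log(1+r)$ if $\alpha=0$, $2\log(1+r) - r$ if $\alpha = 1/2$, and $\frac{(1+r)^{2\alpha}(1+r+2\alpha-2r\alpha) - (1+r)(1+2\alpha)}{2\alpha(1+r)(2\alpha-1)}$ if $\alpha \in (0,1)\setminus\{1/2\}$; equivalently $L(r,\alpha)=\int_0^r (1-\rho)(1+\rho)^{-2(1-\alpha)}d\rho$. (The function $\psi(n,m,\cdot,\alpha)$ is positive near $0$ and tends to $-\infty$ as $r \to 1^-$, so $r_{n,m}$ exists.) *)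

(* Defs.v *)
From Stdlib Require Import Reals Lra Lia.
Open Scope R_scope.

Definition Cx : Type := (R * R)%type.
Definition Cre (z : Cx) : R := fst z.
Definition Cim (z : Cx) : R := snd z.
Definition C0 : Cx := (0, 0).
Definition C1 : Cx := (1, 0).
Definition RtoC (x : R) : Cx := (x, 0).
Definition Cadd (z w : Cx) : Cx := (fst z + fst w, snd z + snd w).
Definition Cmul (z w : Cx) : Cx :=
  (fst z * fst w - snd z * snd w, fst z * snd w + snd z * fst w).
Definition Cconj (z : Cx) : Cx := (fst z, - snd z).
Definition Cnorm2 (z : Cx) : R := fst z * fst z + snd z * snd z.
Definition Cabs (z : Cx) : R := sqrt (Cnorm2 z).
Definition Cinv (z : Cx) : Cx := (fst z / Cnorm2 z, - snd z / Cnorm2 z).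
Definition Cdiv (z w : Cx) : Cx := Cmul z (Cinv w).
Fixpoint Cpow (z : Cx) (k : nat) : Cx :=
  match k with O => C1 | S p => Cmul (Cpow z p) z end.
Definition Cexpi (t : R) : Cx := (cos t, sin t).

Definition ps_sum (c : nat -> Cx) (z : Cx) (l : Cx) : Prop :=
  infinite_sum (fun k => fst (Cmul (c k) (Cpow z k))) (fst l) /\
  infinite_sum (fun k => snd (Cmul (c k) (Cpow z k))) (snd l).

Definition dcoef (c : nat -> Cx) : nat -> Cx :=
  fun k => Cmul (RtoC (INR (S k))) (c (S k)).

(** The class F(alpha): h = sum a_k z^k, g = sum b_k z^k analytic in the unit disk
    (power series converging on D), h(0)=g(0)=0, h'(0)=1,
    h' nonzero and Re(1 + z h''/h') > alpha on D, and g' = e^{i theta} z h' on D. *)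
Definition in_F (alpha : R) (a b : nat -> Cx) : Prop :=
  -1/2 <= alpha /\
  a 0%nat = C0 /\ a 1%nat = C1 /\ b 0%nat = C0 /\
  (forall z, Cabs z < 1 -> exists l, ps_sum a z l) /\
  (forall z, Cabs z < 1 -> exists l, ps_sum b z l) /\
  (forall z d1 d2, Cabs z < 1 ->
     ps_sum (dcoef a) z d1 -> ps_sum (dcoef (dcoef a)) z d2 ->
     d1 <> C0 /\ alpha < Cre (Cadd C1 (Cdiv (Cmul z d2) d1))) /\
  (exists theta : R, forall z d1 e1, Cabs z < 1 ->
     ps_sum (dcoef a) z d1 -> ps_sum (dcoef b) z e1 ->
     e1 = Cmul (Cexpi theta) (Cmul z d1)).

Fixpoint Csum1 (f : nat -> Cx) (n : nat) : Cx :=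
  match n with O => C0 | S p => Cadd (Csum1 f p) (f (S p)) end.

Definition s_poly (a b : nat -> Cx) (n m : nat) (theta : R) (z : Cx) : Cx :=
  Cadd (Csum1 (fun k => Cmul (a k) (Cpow z k)) n)
       (Cmul (Cexpi theta) (Cconj (Csum1 (fun k => Cmul (b k) (Cpow z k)) m))).

Definition univalent_in_disk (F : Cx -> Cx) (r : R) : Prop :=
  forall z w, Cabs z < r -> Cabs w < r -> F z = F w -> z = w.

Definition Lfun (r alpha : R) : R :=
  if Req_EM_T alpha 0 then 2 * r / (1 + r) - ln (1 + r)
  else if Req_EM_T alpha (1/2) then 2 * ln (1 + r) - r
  else (Rpower (1 + r) (2 * alpha) * (1 + r + 2 * alpha - 2 * r * alpha)
          - (1 + r) * (1 + 2 * alpha))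
       / (2 * alpha * (1 + r) * (2 * alpha - 1)).

Definition Acap (r alpha : R) : R := (1 - r ^ 2) / r ^ 2 * (Lfun r alpha) ^ 2.

Fixpoint Aprod (alpha : R) (k : nat) : R :=
  match k with
  | O => 1
  | S p => Aprod alpha p * (if Nat.leb 2 (S p) then INR (S p) - 2 * alpha else 1)
  end.

Definition Ak (alpha : R) (k : nat) : R := / INR (Factorial.fact k) * Aprod alpha k.

Definition psi_is (n m : nat) (r alpha v : R) : Prop :=
  exists s1 s2 : R,
    infinite_sum (fun i => let k := (i + n + 1)%nat in
                   INR k * Ak alpha k * r ^ (k - 1)) s1 /\
    infinite_sum (fun i => let k := (i + m + 1)%nat in
                   INR k * (INR k - 1) / (INR k - 2 * alpha) * Ak alpha k * r ^ (k - 1)) s2 /\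
    v = Acap r alpha - s1 - s2.

Definition smallest_zero_psi (n m : nat) (alpha r0 : R) : Prop :=
  0 < r0 < 1 /\ psi_is n m r0 alpha 0 /\
  (forall r v, 0 < r < r0 -> psi_is n m r alpha v -> v <> 0).

(* Main.v *)
(** The two-point estimate for the harmonic map reduces to one for analytic maps: given
    [z] and [w], some unimodular [u] makes [h + conj g] and [h + u g] have differences of
    equal modulus, and [(h + u g)' = h' (1 + u' z)] with [|u'| = 1].  For [h] in the class,
    with [beta = 2 (1 - alpha)], one shows for [|z|, |w| <= r]
    - [Re ((z h'(z) - w h'(w)) / (h z - h w)) >= 1 - beta r / (1 + r)], and
    - [Re ((F z - F w) / (h z - h w)) >= 1 - r] for [F = h + u g],
    by looking at a minimum over the closed bidisk: there the first-order conditions bound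
    the quotient of differences below by the quotient of derivatives at [z] or at [w].
    Integrating the first inequality along [s -> (s z, s w)] gives
    [|h z - h w| >= |z - w| (1 + r)^(-beta)], hence
    [|F z - F w| >= |z - w| (1 - r) (1 + r)^(-beta)], and this constant dominates
    [Acap r alpha].  The tails of the series are controlled by the coefficient bounds
    [|a_k| <= A_k], which come from Caratheodory's bound for [z h''/h'].  Since the
    constant decreases and the tails increase with [r], the inequality at the zero of psi
    extends strictly to all smaller radii. *)

From Coquelicot Require Import Coquelicot.
From Stdlib Require Import Reals Lra Lia ClassicalEpsilon.
Require Import Defs.
From Coquelicot Require Import Complex.
Open Scope R_scope.

(** The obstacle is a circularity. With [X = z h'(z) / (h z - h w)] and [Y] its counterpart with [z]
    and [w] exchanged, a variable can be moved into its disk at a minimum only if its own term, [X]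
    or [Y], has positive real part. One of them does as soon as [Re (X + Y) > 0], but [X + Y] is the
    very quotient of the first inequality. Positivity is therefore propagated by letting the radius
    of the bidisk grow from 0. Difference quotients are carried by divided differences, which are
    continuous across the diagonal, so that a minimum over the closed bidisk may also lie at
    [z = w]. Function theory is kept to two complex derivatives: they give the maximum principle,
    which gives Schwarz's lemma. The constant dominates [Acap] because
    [L(r) <= r (1 + r)^(-(3 - 2 alpha) / 2)]; this exponent is the one for which
    [(1 - r^2) (1 + r)^(-(3 - 2 alpha))] equals [(1 - r) (1 + r)^(-beta)]. For [alpha = 1/2] both
    tails are geometric, and the radius estimate follows from [r^l <= exp (- l (1 - r))]. *)

(** * Absolutely convergent complex series *)

Definition CSer (u : nat -> C) : C :=
  (Series (fun k => fst (u k)), Series (fun k => snd (u k))).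
Definition csummable (u : nat -> C) : Prop := ex_series (fun k => Cmod (u k)).

Lemma abs_fst_le_Cmod (z : C) : Rabs (fst z) <= Cmod z.
Proof. eapply Rle_trans; [apply Rmax_l | apply (Rmax_Cmod z)]. Qed.

Lemma abs_snd_le_Cmod (z : C) : Rabs (snd z) <= Cmod z.
Proof. eapply Rle_trans; [apply Rmax_r | apply (Rmax_Cmod z)]. Qed.

Lemma Cmod_le_abs (z : C) : Cmod z <= Rabs (fst z) + Rabs (snd z).
Proof.
  replace z with (RtoC (fst z) + Ci * RtoC (snd z))%C at 1.
  - eapply Rle_trans; [apply Cmod_triangle|]; rewrite Cmod_mult, Cmod_Ci, !Cmod_R; lra.
  - destruct z; unfold Ci, RtoC, Cplus, Cmult; simpl; f_equal; ring.
Qed.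

Lemma ex_series_le_R (u v : nat -> R) :
  (forall k, Rabs (u k) <= v k) -> ex_series v -> ex_series u.
Proof. intros H; apply (ex_series_le (V := R_CompleteNormedModule) u v H). Qed.

Lemma csummable_le (u : nat -> C) (v : nat -> R) :
  (forall k, Cmod (u k) <= v k) -> ex_series v -> csummable u.
Proof.
  intros H Hv; apply ex_series_le_R with v; auto.
  intros k; rewrite Rabs_pos_eq; auto using Cmod_ge_0.
Qed.

Lemma csummable_fst (u : nat -> C) : csummable u -> ex_series (fun k => fst (u k)).
Proof. apply ex_series_le_R; intros k; apply abs_fst_le_Cmod. Qed.

Lemma csummable_snd (u : nat -> C) : csummable u -> ex_series (fun k => snd (u k)).
Proof. apply ex_series_le_R; intros k; apply abs_snd_le_Cmod. Qed.

Lemma ex_series_plus_R (u v : nat -> R) :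
  ex_series u -> ex_series v -> ex_series (fun k => u k + v k).
Proof. exact (ex_series_plus (V := R_NormedModule) u v). Qed.

Lemma ex_series_scal_R (c : R) (u : nat -> R) :
  ex_series u -> ex_series (fun k => c * u k).
Proof. exact (ex_series_scal_l c u). Qed.

Lemma csummable_scal (c : C) (u : nat -> C) :
  csummable u -> csummable (fun k => c * u k)%C.
Proof.
  intros Hu; apply csummable_le with (fun k => Cmod c * Cmod (u k)).
  - intros k; rewrite Cmod_mult; lra.
  - now apply ex_series_scal_R.
Qed.

Lemma CSer_ext (u v : nat -> C) : (forall k, u k = v k) -> CSer u = CSer v.
Proof.
  intros H; unfold CSer; f_equal; apply Series_ext; intros k; now rewrite H.
Qed.

Lemma CSer_plus (u v : nat -> C) :
  csummable u -> csummable v -> CSer (fun k => u k + v k)%C = (CSer u + CSer v)%C.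
Proof.
  intros Hu Hv; unfold CSer, Cplus; simpl; f_equal;
    apply Series_plus; auto using csummable_fst, csummable_snd.
Qed.

Lemma CSer_scal (c : C) (u : nat -> C) :
  csummable u -> CSer (fun k => c * u k)%C = (c * CSer u)%C.
Proof.
  intros Hu; pose proof (csummable_fst _ Hu); pose proof (csummable_snd _ Hu).
  unfold CSer, Cmult; simpl; f_equal; rewrite <- !Series_scal_l.
  - rewrite <- Series_minus; auto using ex_series_scal_R.
  - rewrite <- Series_plus; auto using ex_series_scal_R.
Qed.

Lemma unit_rotation (z : C) : exists e : C, Cmod e = 1 /\ (e * z)%C = RtoC (Cmod z).
Proof.
  destruct (Ceq_dec z 0) as [-> | Hz].
  - exists 1%C; split; [apply Cmod_1 |]. rewrite Cmod_0; ring.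
  - exists (RtoC (Cmod z) / z)%C; split.
    + rewrite Cmod_div, Cmod_R by auto.
      rewrite Rabs_pos_eq by apply Cmod_ge_0.
      field; apply Rgt_not_eq, Cmod_gt_0; auto.
    + field; auto.
Qed.

(** Rotating the sum onto the positive real axis reduces the claim to real parts; estimating the two
    components separately would lose a constant factor. *)
Lemma CSer_le (u : nat -> C) (v : nat -> R) :
  (forall k, Cmod (u k) <= v k) -> ex_series v -> Cmod (CSer u) <= Series v.
Proof.
  intros H Hv.
  assert (Hu : csummable u) by now apply csummable_le with v.
  destruct (unit_rotation (CSer u)) as [e [He Hz]].
  rewrite <- CSer_scal in Hz by auto.
  replace (Cmod (CSer u)) with (fst (CSer (fun k => e * u k)%C)) by now rewrite Hz.
  unfold CSer; cbn [fst].
  assert (Hb : forall k, Rabs (fst (e * u k)%C) <= v k).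
  { intros k; eapply Rle_trans; [apply abs_fst_le_Cmod |].
    rewrite Cmod_mult, He; specialize (H k); lra. }
  eapply Rle_trans; [apply Rle_abs |].
  eapply Rle_trans; [apply Series_Rabs |].
  - apply ex_series_le_R with v; auto. intros k; now rewrite Rabs_Rabsolu.
  - apply Series_le; auto. intros k; split; auto using Rabs_pos.
Qed.

Fixpoint Csum (u : nat -> C) (n : nat) : C :=
  match n with O => 0%C | S p => (Csum u p + u p)%C end.

Lemma CSer_split (u : nat -> C) (n : nat) :
  csummable u -> CSer u = (Csum u n + CSer (fun k => u (n + k)%nat))%C.
Proof.
  revert u; induction n as [|n IH]; intros u Hu; simpl.
  - unfold CSer, Cplus; simpl; now rewrite !Rplus_0_l.
  - rewrite (IH u Hu), <- Cplus_assoc; f_equal.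
    assert (Hs : csummable (fun k => u (n + k)%nat)).
    { now apply (ex_series_incr_n (fun k => Cmod (u k)) n). }
    unfold CSer, Cplus; cbn [fst snd].
    rewrite (Series_incr_1 _ (csummable_fst _ Hs)), (Series_incr_1 _ (csummable_snd _ Hs)).
    rewrite Nat.add_0_r; do 2 f_equal; apply Series_ext; intros k;
      now rewrite Nat.add_succ_r.
Qed.

Lemma Csum_ext (u v : nat -> C) (n : nat) :
  (forall k, (k < n)%nat -> u k = v k) -> Csum u n = Csum v n.
Proof.
  induction n as [|n IH]; intros H; simpl; auto.
  rewrite IH, H; auto.
Qed.

Lemma Csum_plus (u v : nat -> C) (n : nat) :
  Csum (fun k => u k + v k)%C n = (Csum u n + Csum v n)%C.
Proof. induction n as [|n IH]; simpl; [ring | rewrite IH; ring]. Qed.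

Lemma Csum_scal (c : C) (u : nat -> C) (n : nat) :
  Csum (fun k => c * u k)%C n = (c * Csum u n)%C.
Proof. induction n as [|n IH]; simpl; [ring | rewrite IH; ring]. Qed.

(** * Power series on the unit disk *)

(** Radius of convergence at least 1, in the absolute form that termwise estimates need. *)
Definition AC (c : nat -> C) : Prop :=
  forall rho, 0 < rho < 1 -> ex_series (fun k => Cmod (c k) * rho ^ k).

Definition PS (c : nat -> C) (z : C) : C := CSer (fun k => c k * z ^ k)%C.

Lemma between_lt_1 (r : R) : r < 1 -> exists rho, r < rho /\ 0 < rho < 1.
Proof.
  intros H; exists ((Rmax r 0 + 1) / 2).
  generalize (Rmax_l r 0) (Rmax_r r 0).
  assert (Rmax r 0 < 1) by (apply Rmax_lub_lt; lra); lra.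
Qed.

Lemma AC_summable (c : nat -> C) (z : C) :
  AC c -> Cmod z < 1 -> csummable (fun k => c k * z ^ k)%C.
Proof.
  intros Hc Hz; destruct (between_lt_1 _ Hz) as [rho [H1 H2]].
  apply csummable_le with (fun k => Cmod (c k) * rho ^ k); auto.
  intros k; rewrite Cmod_mult, Cmod_pow; apply Rmult_le_compat_l; [apply Cmod_ge_0|].
  apply pow_incr; split; [apply Cmod_ge_0 | lra].
Qed.

Lemma AC_le (c d : nat -> C) :
  (forall k, Cmod (d k) <= Cmod (c k)) -> AC c -> AC d.
Proof.
  intros H Hc rho Hr; apply ex_series_le_R with (fun k => Cmod (c k) * rho ^ k); auto.
  intros k; assert (0 <= rho ^ k) by (apply pow_le; lra).
  rewrite Rabs_pos_eq; [now apply Rmult_le_compat_r | apply Rmult_le_pos; auto using Cmod_ge_0].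
Qed.

Lemma AC_plus (c d : nat -> C) : AC c -> AC d -> AC (fun k => c k + d k)%C.
Proof.
  intros Hc Hd rho Hr.
  apply ex_series_le_R with (fun k => Cmod (c k) * rho ^ k + Cmod (d k) * rho ^ k);
    [| now apply ex_series_plus_R; auto].
  intros k; assert (0 <= rho ^ k) by (apply pow_le; lra).
  rewrite Rabs_pos_eq; [| apply Rmult_le_pos; auto using Cmod_ge_0].
  rewrite <- Rmult_plus_distr_r; apply Rmult_le_compat_r; auto using Cmod_triangle.
Qed.

Lemma AC_scal (e : C) (c : nat -> C) : AC c -> AC (fun k => e * c k)%C.
Proof.
  intros Hc rho Hr.
  apply ex_series_ext with (fun k => Cmod e * (Cmod (c k) * rho ^ k)).
  - intros k; rewrite Cmod_mult; lra.
  - now apply ex_series_scal_R; auto.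
Qed.

Lemma AC_shift (c : nat -> C) : AC c -> AC (fun k => c (S k)).
Proof.
  intros Hc rho Hr.
  apply ex_series_ext with (fun k => / rho * (Cmod (c (S k)) * rho ^ S k)).
  - intros k; simpl; field; lra.
  - apply ex_series_scal_R, (ex_series_incr_1 (fun k => Cmod (c k) * rho ^ k)); auto.
Qed.

(** Each of the [k] terms of [1 + s + ... + s^(k-1) = (1 - s^k) / (1 - s)] is at least [s^k]. *)
Lemma INR_mul_pow_bound (s : R) (k : nat) : 0 < s < 1 -> INR k * s ^ k <= / (1 - s).
Proof.
  intros Hs.
  assert (H : INR k * s ^ k <= (1 - s ^ k) / (1 - s)).
  { induction k as [|k IH]; [simpl; lra|].
    rewrite S_INR; simpl pow.
    assert (0 < s ^ k) by (apply pow_lt; lra).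
    replace ((1 - s * s ^ k) / (1 - s)) with ((1 - s ^ k) / (1 - s) + s ^ k) by (field; lra).
    assert (0 <= INR k * s ^ k) by (apply Rmult_le_pos; [apply pos_INR | lra]).
    nra. }
  eapply Rle_trans; [apply H|].
  rewrite <- (Rmult_1_l (/ (1 - s))); apply Rmult_le_compat_r.
  - left; apply Rinv_0_lt_compat; lra.
  - assert (0 < s ^ k) by (apply pow_lt; lra); lra.
Qed.

(** Passing to a radius [r] between [rho] and 1 absorbs the factor [k], because [k (rho / r)^k] is
    bounded. *)
Lemma AC_INR_mul (c : nat -> C) : AC c -> AC (fun k => RtoC (INR k) * c k)%C.
Proof.
  intros Hc rho Hr.
  destruct (between_lt_1 rho) as [r [H1 H2]]; [lra|].
  set (s := rho / r).
  assert (Hs : 0 < s < 1).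
  { unfold s; split; [apply Rdiv_lt_0_compat; lra|].
    apply Rmult_lt_reg_r with r; [lra|]; unfold Rdiv; rewrite Rmult_assoc, Rinv_l; lra. }
  apply ex_series_le_R with (fun k => / (1 - s) * (Cmod (c k) * r ^ k));
    [| now apply ex_series_scal_R; auto].
  intros k; rewrite Cmod_mult, Cmod_R, (Rabs_pos_eq (INR k)) by apply pos_INR.
  replace (rho ^ k) with (s ^ k * r ^ k)
    by (rewrite <- Rpow_mult_distr; f_equal; unfold s; field; lra).
  pose proof (INR_mul_pow_bound s k Hs).
  assert (0 <= Cmod (c k) * r ^ k).
  { apply Rmult_le_pos; [apply Cmod_ge_0 | apply pow_le; lra]. }
  assert (0 <= s ^ k) by (apply pow_le; lra).
  pose proof (pos_INR k).
  rewrite Rabs_pos_eq.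
  - replace (INR k * Cmod (c k) * (s ^ k * r ^ k))
      with (INR k * s ^ k * (Cmod (c k) * r ^ k)) by ring.
    now apply Rmult_le_compat_r.
  - replace (INR k * Cmod (c k) * (s ^ k * r ^ k))
      with (INR k * s ^ k * (Cmod (c k) * r ^ k)) by ring.
    apply Rmult_le_pos; auto; apply Rmult_le_pos; auto.
Qed.

Lemma AC_dcoef (c : nat -> C) : AC c -> AC (dcoef c).
Proof. intros H; exact (AC_shift _ (AC_INR_mul _ H)). Qed.

Lemma Defs_Cpow_eq (z : C) (k : nat) : Defs.Cpow z k = (z ^ k)%C.
Proof.
  induction k as [|k IH]; simpl; [reflexivity|].
  rewrite IH; change (z ^ k * z = z * z ^ k)%C; ring.
Qed.

Lemma Defs_Cabs_eq (z : C) : Cabs z = Cmod z.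
Proof. unfold Cabs, Cnorm2, Cmod; f_equal; ring. Qed.

Lemma ps_sum_PS (c : nat -> C) (z : C) : AC c -> Cmod z < 1 -> ps_sum c z (PS c z).
Proof.
  intros Hc Hz; pose proof (AC_summable c z Hc Hz) as Hs.
  split; apply is_series_Reals.
  - apply is_series_ext with (fun k => fst (c k * z ^ k)%C).
    + intros k; now rewrite Defs_Cpow_eq.
    + apply Series_correct, csummable_fst, Hs.
  - apply is_series_ext with (fun k => snd (c k * z ^ k)%C).
    + intros k; now rewrite Defs_Cpow_eq.
    + apply Series_correct, csummable_snd, Hs.
Qed.

(** Abel's argument: plain convergence at a radius [r > rho] bounds the terms there, and at [rho]
    they are then dominated by a geometric series of ratio [rho / r]. *)
Lemma ps_sum_AC (c : nat -> C) :
  (forall z, Cabs z < 1 -> exists l, ps_sum c z l) -> AC c.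
Proof.
  intros H rho Hr.
  destruct (between_lt_1 rho) as [r [H1 H2]]; [lra|].
  destruct (H (RtoC r)) as [l [Hl1 Hl2]].
  { rewrite Defs_Cabs_eq, Cmod_R, Rabs_pos_eq; lra. }
  assert (Hpow : forall k, Defs.Cpow (RtoC r) k = RtoC (r ^ k)).
  { intros k; rewrite Defs_Cpow_eq; symmetry; apply RtoC_pow. }
  assert (Hb : forall u l', infinite_sum u l' -> exists M, forall k, Rabs (u k) <= M).
  { intros u l' Hu; apply is_series_Reals in Hu.
    assert (Hlim : is_lim_seq u 0) by (apply ex_series_lim_0; now exists l').
    destruct (filterlim_bounded u) as [M HM]; [exists 0; exact Hlim|].
    exists M; exact HM. }
  destruct (Hb _ _ Hl1) as [M1 HM1], (Hb _ _ Hl2) as [M2 HM2].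
  assert (HM : forall k, Cmod (c k) * r ^ k <= M1 + M2).
  { intros k; specialize (HM1 k); specialize (HM2 k); rewrite Hpow in HM1, HM2.
    unfold Cmul, RtoC in HM1, HM2; simpl in HM1, HM2.
    assert (Hk : 0 < r ^ k) by (apply pow_lt; lra).
    rewrite Rmult_0_r, Rminus_0_r in HM1; rewrite Rmult_0_r, Rplus_0_l in HM2.
    rewrite Rabs_mult, (Rabs_pos_eq (r ^ k)) in HM1, HM2 by lra.
    pose proof (Cmod_le_abs (c k)); nra. }
  set (s := rho / r).
  assert (Hs : 0 < s < 1).
  { unfold s; split; [apply Rdiv_lt_0_compat; lra|].
    apply Rmult_lt_reg_r with r; [lra|]; unfold Rdiv; rewrite Rmult_assoc, Rinv_l; lra. }
  apply ex_series_le_R with (fun k => (M1 + M2) * s ^ k).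
  - intros k.
    replace (rho ^ k) with (r ^ k * s ^ k)
      by (rewrite <- Rpow_mult_distr; f_equal; unfold s; field; lra).
    assert (0 <= s ^ k) by (apply pow_le; lra).
    assert (0 <= Cmod (c k) * r ^ k)
      by (apply Rmult_le_pos; [apply Cmod_ge_0 | apply pow_le; lra]).
    rewrite <- Rmult_assoc, Rabs_pos_eq.
    + now apply Rmult_le_compat_r.
    + now apply Rmult_le_pos.
  - apply ex_series_scal_R, ex_series_geom; rewrite Rabs_pos_eq; lra.
Qed.

Lemma PS_plus (c d : nat -> C) (z : C) :
  AC c -> AC d -> Cmod z < 1 -> PS (fun k => c k + d k)%C z = (PS c z + PS d z)%C.
Proof.
  intros Hc Hd Hz; unfold PS; rewrite <- CSer_plus by now apply AC_summable.
  apply CSer_ext; intros k; ring.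
Qed.

Lemma PS_scal (e : C) (c : nat -> C) (z : C) :
  AC c -> Cmod z < 1 -> PS (fun k => e * c k)%C z = (e * PS c z)%C.
Proof.
  intros Hc Hz; unfold PS; rewrite <- CSer_scal by now apply AC_summable.
  apply CSer_ext; intros k; ring.
Qed.

Lemma PS_unshift (c : nat -> C) (z : C) :
  AC c -> Cmod z < 1 -> PS c z = (c 0%nat + z * PS (fun k => c (S k)) z)%C.
Proof.
  intros Hc Hz; unfold PS.
  rewrite (CSer_split _ 1) by now apply AC_summable.
  rewrite <- CSer_scal by now apply (AC_summable (fun k => c (S k)) z (AC_shift _ Hc)).
  simpl; f_equal; [ring | apply CSer_ext; intros k; simpl; ring].
Qed.

Lemma PS_0 (c : nat -> C) : AC c -> PS c 0%C = c 0%nat.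
Proof. intros Hc; rewrite PS_unshift; auto; [ring | rewrite Cmod_0; lra]. Qed.

(** * Divided differences of power series *)

(** The sum of [z^i w^(k-1-i)] over [i < k], that is [(z^k - w^k) / (z - w)] in a form that still
    makes sense for [z = w]. *)
Fixpoint GQ (k : nat) (z w : C) : C :=
  match k with O => 0%C | S p => (z * GQ p z w + w ^ p)%C end.

Lemma GQ_mul (k : nat) (z w : C) : ((z - w) * GQ k z w = z ^ k - w ^ k)%C.
Proof.
  induction k as [|k IH]; simpl; [ring|].
  replace ((z - w) * (z * GQ k z w + w ^ k))%C
    with (z * ((z - w) * GQ k z w) + (z - w) * w ^ k)%C by ring.
  rewrite IH; ring.
Qed.

Lemma GQ_sym (k : nat) (z w : C) : GQ k z w = GQ k w z.
Proof.
  destruct (Ceq_dec z w) as [-> | H]; [reflexivity|].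
  assert (H' : (z - w <> 0)%C) by now apply Cminus_eq_contra.
  replace (GQ k z w) with ((z - w) * GQ k z w / (z - w))%C by now field.
  replace (GQ k w z) with (- ((w - z) * GQ k w z) / (z - w))%C by now field.
  rewrite !GQ_mul; f_equal; ring.
Qed.

Lemma GQ_diag (k : nat) (z : C) : GQ (S k) z z = (RtoC (INR (S k)) * z ^ k)%C.
Proof.
  induction k as [|k IH]; [simpl; ring|].
  change (GQ (S (S k)) z z) with (z * GQ (S k) z z + z ^ S k)%C.
  rewrite IH, (S_INR (S k)), RtoC_plus; simpl Complex.Cpow; ring.
Qed.

Lemma GQ_bound (k : nat) (z w : C) (rho : R) :
  Cmod z <= rho -> Cmod w <= rho -> Cmod (GQ k z w) <= INR k * rho ^ (k - 1).
Proof.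
  intros Hz Hw; pose proof (Cmod_ge_0 z).
  induction k as [|k IH]; [simpl; rewrite Cmod_0; lra|].
  change (GQ (S k) z w) with (z * GQ k z w + w ^ k)%C.
  eapply Rle_trans; [apply Cmod_triangle|].
  rewrite Cmod_mult, Cmod_pow, S_INR.
  assert (Cmod w ^ k <= rho ^ k) by (apply pow_incr; split; auto using Cmod_ge_0).
  assert (Cmod z * Cmod (GQ k z w) <= INR k * rho ^ k).
  { destruct k as [|k]; [simpl; rewrite Cmod_0; lra|].
    replace (INR (S k) * rho ^ S k) with (rho * (INR (S k) * rho ^ (S k - 1)))
      by (replace (S k - 1)%nat with k by lia; simpl pow; ring).
    apply Rmult_le_compat; auto using Cmod_ge_0. }
  replace (S k - 1)%nat with k by lia; lra.
Qed.

(** The factor [rho] on the left replaces the exponent [k - 1], whose truncation at [k = 0] is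
    awkward in sums; [rho ^ 2] does the same for [k - 2] in the Lipschitz estimate. *)
Lemma GQ_bound_mul (k : nat) (z w : C) (rho : R) :
  0 < rho -> Cmod z <= rho -> Cmod w <= rho -> Cmod (GQ k z w) * rho <= INR k * rho ^ k.
Proof.
  intros Hr Hz Hw; pose proof (GQ_bound k z w rho Hz Hw) as H.
  destruct k as [|k]; [simpl; rewrite Cmod_0; lra|].
  replace (S k - 1)%nat with k in H by lia; simpl pow.
  replace (INR (S k) * (rho * rho ^ k)) with (INR (S k) * rho ^ k * rho) by ring.
  apply Rmult_le_compat_r; lra.
Qed.

Lemma GQ_lipschitz (k : nat) (z w z' w' : C) (rho : R) :
  0 < rho -> Cmod z <= rho -> Cmod w <= rho -> Cmod z' <= rho -> Cmod w' <= rho ->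
  Cmod (GQ k z' w' - GQ k z w)%C * rho ^ 2
    <= INR k * INR k * rho ^ k * (Cmod (z' - z)%C + Cmod (w' - w)%C).
Proof.
  intros Hr Hz Hw Hz' Hw'.
  set (dz := Cmod (z' - z)%C); set (dw := Cmod (w' - w)%C).
  assert (Hdz : 0 <= dz) by apply Cmod_ge_0; assert (Hdw : 0 <= dw) by apply Cmod_ge_0.
  induction k as [|k IH].
  { replace (GQ 0 z' w' - GQ 0 z w)%C with (RtoC 0) by (simpl; ring); simpl; rewrite Cmod_0; lra. }
  change (GQ (S k) z' w') with (z' * GQ k z' w' + w' ^ k)%C.
  change (GQ (S k) z w) with (z * GQ k z w + w ^ k)%C.
  (* One factor is changed at a time, and [w' ^ k - w ^ k] is itself a divided difference times
     [w' - w]. *)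
  replace (z' * GQ k z' w' + w' ^ k - (z * GQ k z w + w ^ k))%C with
    (z' * (GQ k z' w' - GQ k z w) + ((z' - z) * GQ k z w + (w' ^ k - w ^ k)))%C by ring.
  rewrite <- (GQ_mul k w' w).
  pose proof (Cmod_triangle (z' * (GQ k z' w' - GQ k z w))
                ((z' - z) * GQ k z w + (w' - w) * GQ k w' w)) as T1.
  pose proof (Cmod_triangle ((z' - z) * GQ k z w) ((w' - w) * GQ k w' w)) as T2.
  rewrite Cmod_mult in T1; rewrite (Cmod_mult (z' - z)), (Cmod_mult (w' - w)) in T2; fold dz dw in T2.
  pose proof (GQ_bound_mul k z w rho Hr Hz Hw) as B1.
  pose proof (GQ_bound_mul k w' w rho Hr Hw' Hw) as B2.
  assert (Hk : 0 <= rho ^ k) by (apply pow_le; lra).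
  pose proof (pos_INR k) as Hn.
  assert (M1 : Cmod z' * Cmod (GQ k z' w' - GQ k z w)%C * rho ^ 2
               <= rho * (INR k * INR k * rho ^ k * (dz + dw))).
  { rewrite Rmult_assoc; apply Rmult_le_compat; auto using Cmod_ge_0.
    apply Rmult_le_pos; [apply Cmod_ge_0 | apply pow2_ge_0]. }
  assert (Hmul : forall d B, 0 <= d -> B * rho <= INR k * rho ^ k ->
                   d * B * rho ^ 2 <= d * (INR k * rho ^ k) * rho).
  { intros d B Hd HB; replace (d * B * rho ^ 2) with (d * (B * rho) * rho) by ring.
    apply Rmult_le_compat_r; [lra | now apply Rmult_le_compat_l]. }
  pose proof (Hmul _ _ Hdz B1) as M2; pose proof (Hmul _ _ Hdw B2) as M3.
  assert (T : Cmod (z' * (GQ k z' w' - GQ k z w)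
                + ((z' - z) * GQ k z w + (w' - w) * GQ k w' w))%C * rho ^ 2
              <= (Cmod z' * Cmod (GQ k z' w' - GQ k z w)%C
                  + (dz * Cmod (GQ k z w) + dw * Cmod (GQ k w' w))) * rho ^ 2).
  { apply Rmult_le_compat_r; [apply pow2_ge_0 | lra]. }
  eapply Rle_trans; [apply T|].
  rewrite S_INR; simpl pow.
  assert (0 <= rho * rho ^ k * (dz + dw) * (INR k + 1)).
  { repeat apply Rmult_le_pos; lra. }
  simpl pow in *; nra.
Qed.

(** Divided difference of the power series: the difference quotient off the diagonal, the derivative
    on it, jointly continuous on the open bidisk. *)
Definition QS (c : nat -> C) (z w : C) : C := CSer (fun k => c k * GQ k z w)%C.

Lemma AC_summable_GQ (c : nat -> C) (z w : C) :
  AC c -> Cmod z < 1 -> Cmod w < 1 -> csummable (fun k => c k * GQ k z w)%C.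
Proof.
  intros Hc Hz Hw.
  destruct (between_lt_1 (Rmax (Cmod z) (Cmod w))) as [rho [H1 H2]];
    [now apply Rmax_lub_lt|].
  pose proof (Rmax_l (Cmod z) (Cmod w)); pose proof (Rmax_r (Cmod z) (Cmod w)).
  apply csummable_le with (fun k => / rho * (Cmod (RtoC (INR k) * c k)%C * rho ^ k)).
  - intros k; rewrite !Cmod_mult, Cmod_R, (Rabs_pos_eq (INR k)) by apply pos_INR.
    pose proof (GQ_bound_mul k z w rho) as B.
    apply Rmult_le_reg_r with rho; [lra|].
    replace (/ rho * (INR k * Cmod (c k) * rho ^ k) * rho)
      with (Cmod (c k) * (INR k * rho ^ k)) by (field; lra).
    rewrite Rmult_assoc; apply Rmult_le_compat_l; [apply Cmod_ge_0 | apply B; lra].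
  - apply ex_series_scal_R, AC_INR_mul; auto.
Qed.

Lemma QS_mul (c : nat -> C) (z w : C) :
  AC c -> Cmod z < 1 -> Cmod w < 1 -> ((z - w) * QS c z w = PS c z - PS c w)%C.
Proof.
  intros Hc Hz Hw; unfold QS, PS.
  rewrite <- CSer_scal by now apply AC_summable_GQ.
  replace (CSer (fun k => c k * z ^ k) - CSer (fun k => c k * w ^ k))%C
    with (CSer (fun k => c k * z ^ k) + (-1) * CSer (fun k => c k * w ^ k))%C by ring.
  rewrite <- CSer_scal by now apply AC_summable.
  rewrite <- CSer_plus; [| now apply AC_summable | now apply csummable_scal, AC_summable].
  apply CSer_ext; intros k.
  replace ((z - w) * (c k * GQ k z w))%C with (c k * ((z - w) * GQ k z w))%C by ring.
  rewrite GQ_mul; ring.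
Qed.

Lemma QS_diag (c : nat -> C) (z : C) :
  AC c -> Cmod z < 1 -> QS c z z = PS (dcoef c) z.
Proof.
  intros Hc Hz; unfold QS, PS.
  rewrite (CSer_split _ 1) by now apply AC_summable_GQ.
  simpl Csum; rewrite Cmult_0_r, !Cplus_0_l.
  apply CSer_ext; intros k; simpl Nat.add.
  rewrite GQ_diag; change (dcoef c k) with (RtoC (INR (S k)) * c (S k))%C; ring.
Qed.

Lemma QS_sym (c : nat -> C) (z w : C) : QS c z w = QS c w z.
Proof. apply CSer_ext; intros k; now rewrite GQ_sym. Qed.

Lemma QS_plus (c d : nat -> C) (z w : C) :
  AC c -> AC d -> Cmod z < 1 -> Cmod w < 1 ->
  QS (fun k => c k + d k)%C z w = (QS c z w + QS d z w)%C.
Proof.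
  intros Hc Hd Hz Hw; unfold QS; rewrite <- CSer_plus by now apply AC_summable_GQ.
  apply CSer_ext; intros k; ring.
Qed.

Lemma QS_scal (e : C) (c : nat -> C) (z w : C) :
  AC c -> Cmod z < 1 -> Cmod w < 1 -> QS (fun k => e * c k)%C z w = (e * QS c z w)%C.
Proof.
  intros Hc Hz Hw; unfold QS; rewrite <- CSer_scal by now apply AC_summable_GQ.
  apply CSer_ext; intros k; ring.
Qed.

Lemma QS_lipschitz (c : nat -> C) (rho : R) :
  AC c -> 0 < rho < 1 -> exists M, 0 <= M /\ forall z w z' w',
    Cmod z <= rho -> Cmod w <= rho -> Cmod z' <= rho -> Cmod w' <= rho ->
    Cmod (QS c z' w' - QS c z w)%C <= M * (Cmod (z' - z)%C + Cmod (w' - w)%C).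
Proof.
  intros Hc Hr.
  (* The Lipschitz constant is the sum of [k^2 |c_k| rho^(k-2)], finite by two uses of
     [AC_INR_mul]. *)
  set (v := fun k => / rho ^ 2 * (Cmod (RtoC (INR k) * (RtoC (INR k) * c k))%C * rho ^ k)).
  assert (Hv : ex_series v) by now apply ex_series_scal_R, AC_INR_mul; [apply AC_INR_mul|].
  assert (Hv0 : forall k, 0 <= v k).
  { intros k; unfold v; apply Rmult_le_pos.
    - left; apply Rinv_0_lt_compat, pow_lt; lra.
    - apply Rmult_le_pos; [apply Cmod_ge_0 | apply pow_le; lra]. }
  exists (Series v); split.
  { rewrite <- (Rmult_0_l (Series v)), <- Series_scal_l.
    apply Series_le; auto; intros k; specialize (Hv0 k); lra. }
  intros z w z' w' Hz Hw Hz' Hw'.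
  set (d := Cmod (z' - z)%C + Cmod (w' - w)%C).
  unfold QS.
  replace (CSer (fun k => c k * GQ k z' w') - CSer (fun k => c k * GQ k z w))%C
    with (CSer (fun k => c k * GQ k z' w') + (-1) * CSer (fun k => c k * GQ k z w))%C by ring.
  rewrite <- CSer_scal by (apply AC_summable_GQ; auto; lra).
  rewrite <- CSer_plus;
    [| apply AC_summable_GQ; auto; lra | apply csummable_scal, AC_summable_GQ; auto; lra].
  rewrite Rmult_comm, <- Series_scal_l.
  apply CSer_le; [| now apply ex_series_scal_R].
  intros k.
  replace (c k * GQ k z' w' + -1 * (c k * GQ k z w))%C
    with (c k * (GQ k z' w' - GQ k z w))%C by ring.
  rewrite Cmod_mult; unfold v; rewrite !Cmod_mult, Cmod_R, (Rabs_pos_eq (INR k)) by apply pos_INR.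
  pose proof (GQ_lipschitz k z w z' w' rho ltac:(lra) Hz Hw Hz' Hw') as B; fold d in B.
  assert (0 < rho ^ 2) by (apply pow_lt; lra).
  apply Rmult_le_reg_r with (rho ^ 2); auto.
  replace (d * (/ rho ^ 2 * (INR k * (INR k * Cmod (c k)) * rho ^ k)) * rho ^ 2)
    with (Cmod (c k) * (INR k * INR k * rho ^ k * d)) by (field; lra).
  rewrite Rmult_assoc; apply Rmult_le_compat_l; auto using Cmod_ge_0.
Qed.

(** * Continuity and complex differentiability *)

Lemma continuous_eps {U : UniformSpace} (f : U -> R) (x : U) :
  continuous f x <-> forall eps, 0 < eps -> locally x (fun y => Rabs (f y - f x) < eps).
Proof.
  unfold continuous; rewrite (filterlim_locally (F := locally x) f (f x)); split.
  - intros H eps He; exact (H (mkposreal eps He)).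
  - intros H eps; exact (H eps (cond_pos eps)).
Qed.

Lemma locally_and {U : UniformSpace} {x : U} {P Q : U -> Prop} :
  locally x P -> locally x Q -> locally x (fun y => P y /\ Q y).
Proof. apply filter_and. Qed.

Lemma locally_preimage {U V : UniformSpace} {f : U -> V} {x : U} {P : V -> Prop} :
  continuous f x -> locally (f x) P -> locally x (fun u => P (f u)).
Proof. intros Hf; exact (Hf P). Qed.

(** Continuity is phrased through [Cmod], so that it does not depend on the choice of a uniform
    structure on the complex numbers. *)
Definition ccont {U : UniformSpace} (f : U -> C) (x : U) : Prop :=
  forall eps, 0 < eps -> locally x (fun y => Cmod (f y - f x)%C < eps).

Lemma ccont_components {U : UniformSpace} (f : U -> C) (x : U) :
  ccont f x <->
  continuous (fun u => fst (f u)) x /\ continuous (fun u => snd (f u)) x.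
Proof.
  rewrite !continuous_eps; split.
  - intros H; split; intros eps He; generalize (H eps He); apply filter_imp; intros y Hy.
    + eapply Rle_lt_trans; [apply (abs_fst_le_Cmod (f y - f x)%C) | exact Hy].
    + eapply Rle_lt_trans; [apply (abs_snd_le_Cmod (f y - f x)%C) | exact Hy].
  - intros [H1 H2] eps He.
    generalize (locally_and (H1 (eps / 2) ltac:(lra)) (H2 (eps / 2) ltac:(lra))).
    apply filter_imp; intros y [Y1 Y2].
    eapply Rle_lt_trans; [apply Cmod_le_abs|]; simpl.
    unfold Rminus in Y1, Y2; lra.
Qed.

Lemma ccont_fst {U : UniformSpace} (f : U -> C) (x : U) :
  ccont f x -> continuous (fun u => fst (f u)) x.
Proof. intros H; now apply ccont_components in H. Qed.

Lemma continuous_mult_R {U : UniformSpace} (f g : U -> R) (x : U) :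
  continuous f x -> continuous g x -> continuous (fun u => f u * g u) x.
Proof. exact (continuous_mult (K := R_AbsRing) f g x). Qed.

Lemma continuous_plus_R {U : UniformSpace} (f g : U -> R) (x : U) :
  continuous f x -> continuous g x -> continuous (fun u => f u + g u) x.
Proof. exact (continuous_plus (V := R_NormedModule) f g x). Qed.

Lemma continuous_minus_R {U : UniformSpace} (f g : U -> R) (x : U) :
  continuous f x -> continuous g x -> continuous (fun u => f u - g u) x.
Proof. exact (continuous_minus (V := R_NormedModule) f g x). Qed.

Lemma continuous_opp_R {U : UniformSpace} (f : U -> R) (x : U) :
  continuous f x -> continuous (fun u => - f u) x.
Proof. exact (continuous_opp (V := R_NormedModule) f x). Qed.

Lemma continuous_inv_R {U : UniformSpace} (f : U -> R) (x : U) :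
  continuous f x -> f x <> 0 -> continuous (fun u => / f u) x.
Proof. intros H H0; apply (continuous_comp f Rinv); auto; now apply continuous_Rinv. Qed.

Lemma ccont_const {U : UniformSpace} (c : C) (x : U) : ccont (fun _ => c) x.
Proof. apply ccont_components; split; apply continuous_const. Qed.

Lemma ccont_plus {U : UniformSpace} (f g : U -> C) (x : U) :
  ccont f x -> ccont g x -> ccont (fun u => f u + g u)%C x.
Proof.
  rewrite !ccont_components; intros [F1 F2] [G1 G2]; split; simpl;
    now apply continuous_plus_R.
Qed.

Lemma ccont_mult {U : UniformSpace} (f g : U -> C) (x : U) :
  ccont f x -> ccont g x -> ccont (fun u => f u * g u)%C x.
Proof.
  rewrite !ccont_components; intros [F1 F2] [G1 G2]; split; simpl.
  - now apply continuous_minus_R; apply continuous_mult_R.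
  - now apply continuous_plus_R; apply continuous_mult_R.
Qed.

Lemma ccont_conj {U : UniformSpace} (f : U -> C) (x : U) :
  ccont f x -> ccont (fun u => Cconj (f u)) x.
Proof.
  rewrite !ccont_components; intros [F1 F2]; split; simpl; auto using continuous_opp_R.
Qed.

Lemma sum_sqr_neq_0 (z : C) : z <> 0%C -> fst z ^ 2 + snd z ^ 2 <> 0.
Proof.
  intros H; destruct z as [x y]; simpl in *; intros E; apply H.
  unfold RtoC; f_equal; nra.
Qed.

Lemma ccont_inv {U : UniformSpace} (f : U -> C) (x : U) :
  ccont f x -> f x <> 0%C -> ccont (fun u => / f u)%C x.
Proof.
  rewrite !ccont_components; intros [F1 F2] H; apply sum_sqr_neq_0 in H.
  assert (HI : continuous (fun u => / (fst (f u) ^ 2 + snd (f u) ^ 2)) x).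
  { apply continuous_inv_R; auto; simpl.
    apply continuous_plus_R; apply continuous_mult_R; auto;
      apply continuous_mult_R; auto; apply continuous_const. }
  split; simpl; apply continuous_mult_R; auto using continuous_opp_R.
Qed.

Lemma ccont_ext_loc {U : UniformSpace} (f g : U -> C) (x : U) :
  locally x (fun u => f u = g u) -> ccont f x -> ccont g x.
Proof.
  intros E H eps He; pose proof (locally_singleton _ _ E) as Ex; simpl in Ex.
  generalize (locally_and E (H eps He)); apply filter_imp.
  intros y [Y1 Y2]; now rewrite <- Y1, <- Ex.
Qed.

Lemma ccont_neq_0 {U : UniformSpace} (f : U -> C) (x : U) :
  ccont f x -> f x <> 0%C -> locally x (fun u => f u <> 0%C).
Proof.
  intros H H0; apply Cmod_gt_0 in H0; generalize (H _ H0); apply filter_imp.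
  intros y Hy E; rewrite E in Hy.
  replace (0 - f x)%C with (- f x)%C in Hy by ring; rewrite Cmod_opp in Hy; lra.
Qed.

Lemma ccont_Cmod {U : UniformSpace} (f : U -> C) (x : U) :
  ccont f x -> continuous (fun u => Cmod (f u)) x.
Proof.
  intros H; apply continuous_eps; intros eps He; generalize (H eps He).
  apply filter_imp; intros y Hy; apply Rle_lt_trans with (2 := Hy).
  apply Rabs_le; split.
  - pose proof (Cmod_triangle (f y) (- (f y - f x))) as T; rewrite Cmod_opp in T.
    replace (f y + - (f y - f x))%C with (f x) in T by ring; lra.
  - pose proof (Cmod_triangle (f x) (f y - f x)) as T.
    replace (f x + (f y - f x))%C with (f y) in T by ring; lra.
Qed.

Lemma ccont_Cmod_lt {U : UniformSpace} (f : U -> C) (x : U) (r : R) :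
  ccont f x -> Cmod (f x) < r -> locally x (fun u => Cmod (f u) < r).
Proof.
  intros H Hr; apply ccont_Cmod in H; rewrite continuous_eps in H.
  generalize (H (r - Cmod (f x)) ltac:(lra)); apply filter_imp; intros y Hy.
  apply Rabs_def2 in Hy; lra.
Qed.

Lemma ccont_Cmod_gt {U : UniformSpace} (f : U -> C) (x : U) (r : R) :
  ccont f x -> r < Cmod (f x) -> locally x (fun u => r < Cmod (f u)).
Proof.
  intros H Hr; apply ccont_Cmod in H; rewrite continuous_eps in H.
  generalize (H (Cmod (f x) - r) ltac:(lra)); apply filter_imp; intros y Hy.
  apply Rabs_def2 in Hy; lra.
Qed.

Lemma ccont_QS {U : UniformSpace} (c : nat -> C) (f g : U -> C) (x : U) :
  AC c -> ccont f x -> ccont g x -> Cmod (f x) < 1 -> Cmod (g x) < 1 ->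
  ccont (fun u => QS c (f u) (g u)) x.
Proof.
  intros Hc Hf Hg F1 G1 eps He.
  destruct (between_lt_1 (Rmax (Cmod (f x)) (Cmod (g x)))) as [rho [R1 R2]];
    [now apply Rmax_lub_lt|].
  pose proof (Rmax_l (Cmod (f x)) (Cmod (g x))); pose proof (Rmax_r (Cmod (f x)) (Cmod (g x))).
  destruct (QS_lipschitz c rho Hc R2) as [M [M0 HM]].
  set (d := eps / (2 * (M + 1))).
  assert (Hd : 0 < d) by (apply Rdiv_lt_0_compat; lra).
  generalize (locally_and (locally_and (Hf d Hd) (Hg d Hd))
    (locally_and (ccont_Cmod_lt f x rho Hf ltac:(lra)) (ccont_Cmod_lt g x rho Hg ltac:(lra)))).
  apply filter_imp; intros y [[Y1 Y2] [Y3 Y4]].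
  eapply Rle_lt_trans; [apply HM; lra|].
  apply Rle_lt_trans with (M * (2 * d)); [apply Rmult_le_compat_l; lra|].
  assert (E : eps = (M + 1) * (2 * d)) by (unfold d; field; lra).
  rewrite E; apply Rmult_lt_compat_r; lra.
Qed.

Lemma ccont_id (z : C_UniformSpace) : ccont (fun z : C_UniformSpace => z) z.
Proof.
  apply ccont_components; split.
  - apply (continuous_fst (U := R_UniformSpace) (V := R_UniformSpace)).
  - apply (continuous_snd (U := R_UniformSpace) (V := R_UniformSpace)).
Qed.

Definition CC : UniformSpace := prod_UniformSpace C_UniformSpace C_UniformSpace.

Lemma ccont_CC_fst (p : CC) : ccont (fun p : CC => fst p) p.
Proof.
  intros eps He.
  destruct p as [z w].
  apply (continuous_fst (U := C_UniformSpace) (V := C_UniformSpace) z w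
    (fun y => Cmod (y - fst (z, w))%C < eps)).
  exact (ccont_id (z) eps He).
Qed.

Lemma ccont_CC_snd (p : CC) : ccont (fun p : CC => snd p) p.
Proof.
  intros eps He.
  destruct p as [z w].
  apply (continuous_snd (U := C_UniformSpace) (V := C_UniformSpace) z w
    (fun y => Cmod (y - snd (z, w))%C < eps)).
  exact (ccont_id (w) eps He).
Qed.

Lemma ccont_comp {U V : UniformSpace} (f : U -> V) (g : V -> C) (x : U) :
  continuous f x -> ccont g (f x) -> ccont (fun u => g (f u)) x.
Proof. intros Hf Hg eps He; exact (Hf _ (Hg eps He)). Qed.

Lemma ccont_continuous {U : UniformSpace} (f : U -> C) (x : U) :
  ccont f x -> continuous (U := C_UniformSpace) f x.
Proof.
  intros H P [d Hd]; unfold filtermap; generalize (H d (cond_pos d)); apply filter_imp.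
  intros y Hy; apply Hd; apply C_NormedModule_mixin_compat1; exact Hy.
Qed.

(** Differentiability in Caratheodory's form: the difference quotient extends continuously. *)
Definition cderiv (f : C -> C) (z d : C) : Prop :=
  exists q : C -> C, ccont (U := C_UniformSpace) q z /\ q z = d /\
    @locally C_UniformSpace z (fun z' => (f z' - f z = (z' - z) * q z')%C).

Lemma cderiv_ccont (f : C -> C) (z d : C) : cderiv f z d -> ccont (U := C_UniformSpace) f z.
Proof.
  intros [q [Hq [_ E]]].
  apply ccont_ext_loc with (fun z' => f z + (z' + - z) * q z')%C.
  - revert E; apply filter_imp; intros z' Hz'.
    change ((f z + (z' - z) * q z')%C = f z'); rewrite <- Hz'; ring.
  - apply ccont_plus; [apply ccont_const|]; apply ccont_mult; auto.
    apply ccont_plus; [apply ccont_id | apply ccont_const].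
Qed.

Lemma cderiv_const (c z : C) : cderiv (fun _ => c) z 0%C.
Proof.
  exists (fun _ => 0%C); split; [apply ccont_const | split; auto].
  apply filter_forall; intros z'; ring.
Qed.

Lemma cderiv_id (z : C) : cderiv (fun z => z) z 1%C.
Proof.
  exists (fun _ => 1%C); split; [apply ccont_const | split; auto].
  apply filter_forall; intros z'; ring.
Qed.

Lemma cderiv_plus (f g : C -> C) (z df dg : C) :
  cderiv f z df -> cderiv g z dg -> cderiv (fun z => f z + g z)%C z (df + dg)%C.
Proof.
  intros [q [Hq [Q E]]] [q' [Hq' [Q' E']]].
  exists (fun z => q z + q' z)%C; split; [now apply ccont_plus | split; [now subst|]].
  generalize (locally_and E E'); apply filter_imp; intros y [Y Y'].
  replace (f y + g y - (f z + g z))%C with ((f y - f z) + (g y - g z))%C by ring.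
  rewrite Y, Y'; ring.
Qed.

Lemma cderiv_mult (f g : C -> C) (z df dg : C) :
  cderiv f z df -> cderiv g z dg ->
  cderiv (fun z => f z * g z)%C z (df * g z + f z * dg)%C.
Proof.
  intros [q [Hq [Q E]]] H; pose proof (cderiv_ccont _ _ _ H) as Cg.
  destruct H as [q' [Hq' [Q' E']]].
  exists (fun y => q y * g y + f z * q' y)%C; split; [| split; [now subst|]].
  - apply ccont_plus; apply ccont_mult; auto using ccont_const.
  - generalize (locally_and E E'); apply filter_imp; intros y [Y Y'].
    replace (f y * g y - f z * g z)%C with ((f y - f z) * g y + f z * (g y - g z))%C by ring.
    rewrite Y, Y'; ring.
Qed.

Lemma cderiv_inv (f : C -> C) (z df : C) :
  cderiv f z df -> f z <> 0%C -> cderiv (fun z => / f z)%C z (- df * (/ f z * / f z))%C.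
Proof.
  intros H H0; pose proof (cderiv_ccont _ _ _ H) as Cf; destruct H as [q [Hq [Q E]]].
  exists (fun y => (- (1) * q y) * (/ f z * / f y))%C; split; [| split].
  - repeat apply ccont_mult; auto using ccont_const, ccont_inv.
  - rewrite Q; ring.
  - generalize (locally_and E (ccont_neq_0 _ _ Cf H0)); apply filter_imp.
    intros y [Y Y0].
    replace (/ f y - / f z)%C with (- (f y - f z) * (/ f z * / f y))%C by (field; auto).
    rewrite Y; ring.
Qed.

Lemma cderiv_eq (f : C -> C) (z d d' : C) : d = d' -> cderiv f z d -> cderiv f z d'.
Proof. now intros ->. Qed.

Lemma cderiv_scaled_arg (f : C -> C) (w z d : C) :
  cderiv f (w * z)%C d -> cderiv (fun z => f (w * z)%C) z (w * d)%C.
Proof.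
  intros [q [Hq [Q E]]].
  assert (Cw : continuous (T := C_UniformSpace) (U := C_UniformSpace) (fun z => w * z)%C z).
  { apply ccont_continuous, ccont_mult; [apply ccont_const | apply ccont_id]. }
  exists (fun z => w * q (w * z))%C; split; [| split; [now rewrite Q|]].
  - apply ccont_mult; [apply ccont_const |].
    apply (ccont_comp (U := C_UniformSpace) (V := C_UniformSpace) (fun z => w * z)%C q); auto.
  - generalize (locally_preimage Cw E); apply filter_imp; intros y Y; rewrite Y; ring.
Qed.

Lemma locally_disk (z : C) (r : R) :
  Cmod z < r -> @locally C_UniformSpace z (fun y => Cmod y < r).
Proof. apply (ccont_Cmod_lt (U := C_UniformSpace) (fun z => z)), ccont_id. Qed.

Lemma cderiv_PS (c : nat -> C) (z : C) :
  AC c -> Cmod z < 1 -> cderiv (PS c) z (PS (dcoef c) z).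
Proof.
  intros Hc Hz; exists (fun y => QS c y z); split; [| split].
  - apply ccont_QS; auto using ccont_const; apply ccont_id.
  - now apply QS_diag.
  - generalize (locally_disk z 1 Hz); apply filter_imp; intros y Hy.
    symmetry; now apply QS_mul.
Qed.

(** Two complex derivatives, with no continuity of the second, suffice for the maximum principle.
    The class is stable under products and inverses by the calculus rules alone, so no power series
    of a quotient has to be built. *)
Definition holo2 (f : C -> C) : Prop :=
  exists f1 f2 : C -> C, forall z, Cmod z < 1 -> cderiv f z (f1 z) /\ cderiv f1 z (f2 z).

Lemma holo2_const (c : C) : holo2 (fun _ => c).
Proof.
  exists (fun _ => 0%C), (fun _ => 0%C); intros z _; split; apply cderiv_const.
Qed.

Lemma holo2_id : holo2 (fun z => z).
Proof.
  exists (fun _ => 1%C), (fun _ => 0%C); intros z _; split;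
    [apply cderiv_id | apply cderiv_const].
Qed.

Lemma holo2_PS (c : nat -> C) : AC c -> holo2 (PS c).
Proof.
  intros Hc; exists (PS (dcoef c)), (PS (dcoef (dcoef c))); intros z Hz; split;
    apply cderiv_PS; auto using AC_dcoef.
Qed.

Lemma holo2_plus (f g : C -> C) : holo2 f -> holo2 g -> holo2 (fun z => f z + g z)%C.
Proof.
  intros [f1 [f2 Hf]] [g1 [g2 Hg]].
  exists (fun z => f1 z + g1 z)%C, (fun z => f2 z + g2 z)%C; intros z Hz.
  destruct (Hf z Hz), (Hg z Hz); split; now apply cderiv_plus.
Qed.

Lemma holo2_mult (f g : C -> C) : holo2 f -> holo2 g -> holo2 (fun z => f z * g z)%C.
Proof.
  intros [f1 [f2 Hf]] [g1 [g2 Hg]].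
  exists (fun z => f1 z * g z + f z * g1 z)%C,
    (fun z => (f2 z * g z + f1 z * g1 z) + (f1 z * g1 z + f z * g2 z))%C; intros z Hz.
  destruct (Hf z Hz), (Hg z Hz); split; [now apply cderiv_mult|].
  apply cderiv_plus; now apply cderiv_mult.
Qed.

Lemma holo2_inv (f : C -> C) :
  holo2 f -> (forall z, Cmod z < 1 -> f z <> 0%C) -> holo2 (fun z => / f z)%C.
Proof.
  intros [f1 [f2 Hf]] H0.
  set (g1 := fun z => (- f1 z * (/ f z * / f z))%C).
  exists (fun z => (- (1) * f1 z) * (/ f z * / f z))%C,
    (fun z => ((0 * f1 z + - (1) * f2 z) * (/ f z * / f z)
               + (- (1) * f1 z) * (g1 z * / f z + / f z * g1 z)))%C.
  intros z Hz; destruct (Hf z Hz) as [D1 D2].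
  assert (DI : cderiv (fun z => / f z)%C z (g1 z)) by (apply cderiv_inv; auto).
  split.
  - eapply cderiv_eq; [| exact DI]; unfold g1; ring.
  - apply (cderiv_mult (fun z => - (1) * f1 z)%C (fun z => / f z * / f z)%C).
    + apply (cderiv_mult (fun _ => - (1))%C f1); auto using cderiv_const.
    + now apply (cderiv_mult (fun z => / f z)%C (fun z => / f z)%C).
Qed.

Lemma holo2_scaled_arg (f : C -> C) (w : C) :
  Cmod w <= 1 -> holo2 f -> holo2 (fun z => f (w * z)%C).
Proof.
  intros Hw [f1 [f2 Hf]].
  exists (fun z => w * f1 (w * z))%C, (fun z => 0 * f1 (w * z) + w * (w * f2 (w * z)))%C.
  intros z Hz.
  assert (Hwz : Cmod (w * z)%C < 1).
  { rewrite Cmod_mult; pose proof (Cmod_ge_0 w); pose proof (Cmod_ge_0 z); nra. }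
  destruct (Hf _ Hwz); split; [now apply (cderiv_scaled_arg f)|].
  apply (cderiv_mult (fun _ => w) (fun z => f1 (w * z)%C)); auto using cderiv_const.
  now apply (cderiv_scaled_arg f1).
Qed.

Lemma holo2_pow (k : nat) : holo2 (fun z => z ^ k)%C.
Proof.
  induction k as [|k IH]; [exact (holo2_const 1%C)|].
  exact (holo2_mult _ _ holo2_id IH).
Qed.

Lemma holo2_Csum (f : nat -> C -> C) (n : nat) :
  (forall j, holo2 (f j)) -> holo2 (fun z => Csum (fun j => f j z) n).
Proof.
  intros H; induction n as [|n IH]; [exact (holo2_const 0%C)|].
  exact (holo2_plus _ _ IH (H n)).
Qed.

Lemma is_derive_caratheodory (F g : R -> R) (x : R) :
  continuous g x -> locally x (fun y => F y - F x = (y - x) * g y) -> is_derive F x (g x).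
Proof.
  intros Hg [d Hd]; apply is_derive_Reals; intros eps He.
  rewrite continuous_eps in Hg; destruct (Hg eps He) as [d' Hd'].
  exists (mkposreal (Rmin d d') (Rmin_stable_in_posreal d d')); intros h h0 Hh; simpl in Hh.
  pose proof (Rmin_l d d'); pose proof (Rmin_r d d').
  assert (B : Rabs (x + h - x) < Rmin d d') by now replace (x + h - x) with h by ring.
  assert (B1 : ball x d (x + h)) by (change (Rabs (x + h - x) < d); lra).
  assert (B2 : ball x d' (x + h)) by (change (Rabs (x + h - x) < d'); lra).
  rewrite (Hd _ B1).
  replace ((x + h - x) * g (x + h) / h) with (g (x + h)) by (field; auto).
  now apply Hd'.
Qed.

Lemma ccont_line (z v : C) (s : R) : ccont (fun s : R => z + RtoC s * v)%C s.
Proof.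
  apply ccont_plus; [apply ccont_const|]; apply ccont_mult; [| apply ccont_const].
  apply ccont_components; split; simpl; [apply continuous_id | apply continuous_const].
Qed.

Lemma cderiv_line (f : C -> C) (z v d : C) (s : R) :
  cderiv f (z + RtoC s * v)%C d ->
  is_derive (fun s => fst (f (z + RtoC s * v)%C)) s (fst (d * v)%C).
Proof.
  intros [q [Hq [Q E]]].
  pose proof (ccont_continuous _ _ (ccont_line z v s)) as CL.
  rewrite <- Q.
  apply (is_derive_caratheodory _ (fun s => fst (q (z + RtoC s * v) * v)%C)).
  - apply ccont_fst, ccont_mult; [| apply ccont_const].
    now apply (ccont_comp (V := C_UniformSpace) (fun s : R => z + RtoC s * v)%C q).
  - generalize (locally_preimage CL E); apply filter_imp; intros y Y.
    change (fst (f (z + RtoC y * v) - f (z + RtoC s * v))%C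
            = (y - s) * fst (q (z + RtoC y * v) * v)%C).
    rewrite Y; replace (z + RtoC y * v - (z + RtoC s * v))%C with (RtoC (y - s) * v)%C
      by (rewrite RtoC_minus; ring).
    simpl; ring.
Qed.

(** * Compactness of the closed bidisk *)

Definition in_bidisk (t : R) (p : CC) : Prop := Cmod (fst p) <= t /\ Cmod (snd p) <= t.

(** Compactness in local-to-uniform form. It serves three times: for a lower bound of a continuous
    function, for attaining its infimum, and for enlarging the radius in the continuity method. *)
Lemma bidisk_uniform (P : CC -> R -> Prop) :
  (forall p, exists d, 0 < d /\ locally p (fun x => P x d)) ->
  (forall x d d', 0 < d' <= d -> P x d -> P x d') ->
  exists d, 0 < d /\ forall x, in_bidisk 1 x -> P x d.
Proof.
  intros HP Hmono.
  assert (HP' : forall p : CC, exists d : posreal, forall x, ball p d x -> P x d).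
  { intros p; destruct (HP p) as [d [Hd [e He]]].
    exists (mkposreal (Rmin d e) (Rmin_stable_in_posreal (mkposreal d Hd) e)); simpl.
    intros x Hx; apply Hmono with d.
    - split; [apply (Rmin_stable_in_posreal (mkposreal d Hd) e) | apply Rmin_l].
    - apply He; eapply ball_le; [apply Rmin_r | exact Hx]. }
  (* A choice of local radii is a gauge, to which compactness of the box [[-1, 1]^4] applies. *)
  set (delta := fun p => proj1_sig (constructive_indefinite_description _ (HP' p))).
  assert (Hdelta : forall p x, ball p (delta p) x -> P x (delta p)).
  { intros p; exact (proj2_sig (constructive_indefinite_description _ (HP' p))). }
  set (unp := fun t : Compactness.Tn 4 R =>
    match t with (x1, (x2, (x3, (x4, _)))) => (((x1, x2), (x3, x4)) : CC) end).
  destruct (compactness_value 4 (-1, (-1, (-1, (-1, tt)))) (1, (1, (1, (1, tt))))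
              (fun t => delta (unp t))) as [d Hd].
  exists d; split; [apply cond_pos|].
  intros [[x1 x2] [x3 x4]] [B1 B2]; simpl in B1, B2.
  pose proof (abs_fst_le_Cmod (x1, x2)) as A1; pose proof (abs_snd_le_Cmod (x1, x2)) as A2.
  pose proof (abs_fst_le_Cmod (x3, x4)) as A3; pose proof (abs_snd_le_Cmod (x3, x4)) as A4.
  simpl in A1, A2, A3, A4.
  apply NNPP; intros HN.
  apply (Hd (x1, (x2, (x3, (x4, tt))))).
  { assert (B : forall x, Rabs x <= 1 -> -1 <= x <= 1)
      by (intros x Hx; now apply Rabs_le_between).
    split; [apply B; lra|]; split; [apply B; lra|]; split; [apply B; lra|].
    split; [apply B; lra | exact I]. }
  intros [[t1 [t2 [t3 [t4 []]]]] [_ [Hc Hle]]]; apply HN.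
  apply Hmono with (delta (unp (t1, (t2, (t3, (t4, tt)))))); [split; [apply cond_pos | exact Hle]|].
  apply Hdelta; destruct Hc as [C1 [C2 [C3 [C4 _]]]].
  repeat split; simpl; assumption.
Qed.

Lemma not_in_bidisk_locally (t : R) (p : CC) :
  ~ in_bidisk t p -> exists t', t < t' /\ locally p (fun x => ~ in_bidisk t' x).
Proof.
  intros H; apply not_and_or in H.
  destruct H as [H|H]; apply Rnot_le_lt in H.
  - exists ((t + Cmod (fst p)) / 2); split; [lra|].
    generalize (ccont_Cmod_gt _ p ((t + Cmod (fst p)) / 2) (ccont_CC_fst p) ltac:(lra)).
    apply filter_imp; intros x Hx [Y Y2]; exact (Rlt_not_le _ _ Hx Y).
  - exists ((t + Cmod (snd p)) / 2); split; [lra|].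
    generalize (ccont_Cmod_gt _ p ((t + Cmod (snd p)) / 2) (ccont_CC_snd p) ltac:(lra)).
    apply filter_imp; intros x Hx [Y Y2]; exact (Rlt_not_le _ _ Hx Y2).
Qed.

Lemma bidisk_min (f : CC -> R) (t : R) :
  0 <= t <= 1 -> (forall p, in_bidisk t p -> continuous f p) ->
  exists p, in_bidisk t p /\ forall x, in_bidisk t x -> f p <= f x.
Proof.
  intros Ht Hf.
  assert (sub : forall x, in_bidisk t x -> in_bidisk 1 x) by (intros x []; split; lra).
  (* Relativised to the bidisk of radius [t]: near a point outside, a whole neighbourhood is outside
     and the condition is vacuous. *)
  assert (Hloc : forall (Q : CC -> R -> Prop),
    (forall p, in_bidisk t p -> exists d, 0 < d /\ locally p (fun x => Q x d)) ->
    (forall x d d', 0 < d' <= d -> Q x d -> Q x d') ->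
    exists d, 0 < d /\ forall x, in_bidisk t x -> Q x d).
  { intros Q HQ Hm.
    destruct (bidisk_uniform (fun x d => in_bidisk t x -> Q x d)) as [d [Hd H]].
    - intros p; destruct (classic (in_bidisk t p)) as [Hp | Hp].
      + destruct (HQ p Hp) as [d [Hd H]]; exists d; split; auto.
        revert H; apply filter_imp; auto.
      + destruct (not_in_bidisk_locally t p Hp) as [t' [Ht' H]].
        exists 1; split; [lra|].
        revert H; apply filter_imp; intros x Hx []; exfalso; apply Hx; split; lra.
    - intros x d d' Hd HQx Hx; eauto.
    - exists d; split; auto. }
  (* The lower bound is written [- / d] so that shrinking [d] weakens it. *)
  destruct (Hloc (fun x d => - / d <= f x)) as [d0 [Hd0 H0]].
  { intros p Hp; exists (/ (Rabs (f p) + 1)).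
    pose proof (Rabs_pos (f p)).
    split; [apply Rinv_0_lt_compat; lra|].
    rewrite Rinv_inv; specialize (Hf p Hp); rewrite continuous_eps in Hf.
    generalize (Hf 1 ltac:(lra)); apply filter_imp; intros x Hx.
    apply Rabs_def2 in Hx; pose proof (Rle_abs (- f p)); rewrite Rabs_Ropp in *; lra. }
  { intros x d d' [Hd' Hd] H; eapply Rle_trans; [| exact H].
    apply Ropp_le_contravar, Rinv_le_contravar; lra. }
  set (E := fun y => exists x, in_bidisk t x /\ y = - f x).
  destruct (completeness E) as [m [Hm1 Hm2]].
  { exists (/ d0); intros y [x [Hx ->]]; specialize (H0 x Hx); lra. }
  { exists (- f ((0, 0), (0, 0))), ((0, 0), (0, 0)); split; auto.
    split; simpl; rewrite (Cmod_0 : Cmod (0, 0) = 0); lra. }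
  apply NNPP; intros HN.
  assert (Hgt : forall p, in_bidisk t p -> - m < f p).
  { intros p Hp; apply Rnot_le_lt; intros Hle; apply HN; exists p; split; auto.
    intros x Hx; assert (- f x <= m) by (apply Hm1; now exists x); lra. }
  (* Here [- m] is the infimum of [f]. If it is not attained, compactness yields a uniform gap [d]
     above it, which contradicts that [m] is the least upper bound of [- f]. *)
  destruct (Hloc (fun x d => - m + d <= f x)) as [d [Hd H]].
  { intros p Hp; specialize (Hgt p Hp); exists ((f p + m) / 2); split; [lra|].
    specialize (Hf p Hp); rewrite continuous_eps in Hf.
    generalize (Hf ((f p + m) / 2) ltac:(lra)); apply filter_imp; intros x Hx.
    apply Rabs_def2 in Hx; lra. }
  { intros x d d' Hd H; lra. }
  assert (m <= m - d); [| lra].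
  apply Hm2; intros y [x [Hx ->]]; specialize (H x Hx); lra.
Qed.

(** * Maximum principle and Schwarz lemma *)

Lemma no_strict_convex_max (u u1 : R -> R) (u2 d : R) :
  0 < d -> (forall s, Rabs s < d -> is_derive u s (u1 s)) -> is_derive u1 0 u2 -> 0 < u2 ->
  ~ (forall s, Rabs s < d -> u s <= u 0).
Proof.
  intros Hd Hu Hu1 H2 Hmax.
  apply is_derive_Reals in Hu1; destruct (Hu1 u2 H2) as [e He].
  assert (Hs : forall s, s <> 0 -> Rabs s < e -> 0 < (u1 s - u1 0) / s).
  { intros s s0 Hs; specialize (He s s0 Hs); rewrite Rplus_0_l in He.
    apply Rabs_def2 in He; lra. }
  set (r := Rmin d e / 2).
  assert (Hr : 0 < r /\ r < d /\ r < e).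
  { pose proof (Rmin_l d e); pose proof (Rmin_r d e).
    assert (0 < Rmin d e) by (apply Rmin_pos; auto; apply cond_pos).
    unfold r; lra. }
  destruct Hr as [R1 [R2 R3]].
  (* By [Hs] the slope [u1] increases through 0: if it is nonnegative there, [u] grows to the right,
     otherwise it grows to the left. *)
  destruct (Rle_lt_dec 0 (u1 0)) as [Hp | Hn].
  - destruct (MVT_cor2 u u1 0 r R1) as [c [Ec Hc]].
    { intros c Hc; apply is_derive_Reals, Hu; rewrite Rabs_pos_eq; lra. }
    assert (P : 0 < (u1 c - u1 0) / c) by (apply Hs; [lra | rewrite Rabs_pos_eq; lra]).
    assert (0 < u1 c - u1 0).
    { replace (u1 c - u1 0) with ((u1 c - u1 0) / c * c) by (field; lra).
      apply Rmult_lt_0_compat; lra. }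
    assert (u r <= u 0) by (apply Hmax; rewrite Rabs_pos_eq; lra).
    nra.
  - destruct (MVT_cor2 u u1 (- r) 0) as [c [Ec Hc]]; [lra | |].
    { intros c Hc; apply is_derive_Reals, Hu; apply Rabs_def1; lra. }
    assert (P : 0 < (u1 c - u1 0) / c) by (apply Hs; [lra | apply Rabs_def1; lra]).
    assert (0 < u1 0 - u1 c).
    { replace (u1 0 - u1 c) with ((u1 c - u1 0) / c * - c) by (field; lra).
      apply Rmult_lt_0_compat; lra. }
    assert (u (- r) <= u 0) by (apply Hmax; apply Rabs_def1; lra).
    nra.
Qed.

Definition sqn (z : C) : R := fst z * fst z + snd z * snd z.

Lemma sqn_Cmod (z : C) : sqn z = Cmod z * Cmod z.
Proof.
  unfold sqn, Cmod; rewrite sqrt_sqrt; [ring|].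
  pose proof (pow2_ge_0 (fst z)); pose proof (pow2_ge_0 (snd z)); lra.
Qed.

(* [Re q + eta |z|^2] has no interior maximum, since its Laplacian is [4 eta > 0]. *)
Lemma max_principle (q : C -> C) (rho B : R) :
  0 < rho < 1 -> holo2 q -> (forall z, Cmod z = rho -> fst (q z) <= B) ->
  forall z, Cmod z <= rho -> fst (q z) <= B.
Proof.
  intros Hr [q1 [q2 Hq]] HB z0 Hz0; apply Rnot_lt_le; intros Hlt.
  (* Half the supposed excess: on the circle, where [|z| < 1], the perturbed function is at most
     [B + eta], while at [z0] it is at least [B + 2 eta]. *)
  set (eta := (fst (q z0) - B) / 2).
  destruct (bidisk_min (fun p => - (fst (q (fst p)) + eta * sqn (fst p))) rho) as [[z w] [Hp Hmin]];
    [lra | |].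
  { intros p [Hp _]; apply continuous_opp_R, continuous_plus_R.
    - apply ccont_fst, (ccont_comp (V := C_UniformSpace) (fun p : CC => fst p) q).
      + apply ccont_continuous, ccont_CC_fst.
      + eapply cderiv_ccont, Hq; lra.
    - apply continuous_mult_R; [apply continuous_const|].
      pose proof (ccont_CC_fst p) as H; apply ccont_components in H; destruct H.
      apply continuous_plus_R; now apply continuous_mult_R. }
  assert (Hmax : forall y, Cmod y <= rho ->
    fst (q y) + eta * sqn y <= fst (q z) + eta * sqn z).
  { intros y Hy; specialize (Hmin (y, y) (conj Hy Hy)); simpl in Hmin; lra. }
  destruct Hp as [Hz _]; simpl in Hz.
  assert (Heta : 0 < eta) by (unfold eta; lra).
  assert (Hsq : 0 <= sqn z0) by (rewrite sqn_Cmod; apply Rmult_le_pos; apply Cmod_ge_0).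
  destruct (Rle_lt_or_eq_dec _ _ Hz) as [Hin | Hbd].
  - assert (Hline : forall v, Cmod v = 1 -> ~ 0 < fst (q2 z * v * v)%C + 2 * eta).
    { intros v Hv Hpos.
      assert (Hv2 : sqn v = 1) by (rewrite sqn_Cmod, Hv; ring).
      assert (Hs : forall s, Rabs s < rho - Cmod z -> Cmod (z + RtoC s * v)%C < rho).
      { intros s Hs; eapply Rle_lt_trans; [apply Cmod_triangle|].
        rewrite Cmod_mult, Cmod_R, Hv; lra. }
      assert (Hz' : (z + RtoC 0 * v)%C = z) by ring.
      apply (no_strict_convex_max
        (fun s => fst (q (z + RtoC s * v)%C) + eta * sqn (z + RtoC s * v)%C)
        (fun s => fst (q1 (z + RtoC s * v) * v)%C
                  + eta * (2 * (fst z * fst v + snd z * snd v) + 2 * s))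
        (fst (q2 z * v * v)%C + 2 * eta) (rho - Cmod z)); [lra | | | exact Hpos |].
      - intros s Hs'; apply (is_derive_plus (V := R_NormedModule)).
        + apply cderiv_line, Hq; specialize (Hs s Hs'); lra.
        + apply is_derive_ext with (fun s => eta * (sqn z
             + 2 * (fst z * fst v + snd z * snd v) * s + s * s)).
          * intros t; rewrite <- (Rmult_1_r (t * t)), <- Hv2; unfold sqn; simpl; ring.
          * auto_derive; auto; ring.
      - apply (is_derive_plus (V := R_NormedModule)); [| auto_derive; auto; ring].
        rewrite <- Hz' at 1.
        apply (cderiv_line (fun z => q1 z * v)%C).
        eapply cderiv_eq; [| apply cderiv_mult; [apply Hq; rewrite Hz'; lra | apply cderiv_const]].
        rewrite Hz'; ring.
      - intros s Hs'; rewrite Hz'; apply Hmax; left; auto. }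
    (* In the directions 1 and i the second derivatives are [Re q2 + 2 eta] and [- Re q2 + 2 eta];
       their sum [4 eta] is positive, so they are not both nonpositive. *)
    pose proof (Hline 1%C Cmod_1) as L1; pose proof (Hline Ci Cmod_Ci) as L2.
    simpl in L1, L2; lra.
  - specialize (HB z Hbd); specialize (Hmax z0 Hz0).
    assert (sqn z <= 1) by (rewrite sqn_Cmod, Hbd; nra).
    assert (0 <= eta * sqn z0) by (apply Rmult_le_pos; lra).
    assert (eta * sqn z <= eta * 1) by (apply Rmult_le_compat_l; lra).
    unfold eta in *; lra.
Qed.

Lemma pow_near_1 (x : R) (k : nat) (r0 : R) :
  r0 < 1 -> (forall rho, r0 < rho -> 0 < rho < 1 -> x * rho ^ k <= 1) -> x <= 1.
Proof.
  intros Hr H; apply Rnot_lt_le; intros Hx.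
  assert (Hk : continuous (fun rho => x * rho ^ k) 1).
  { apply continuous_mult_R; [apply continuous_const|].
    apply (ex_derive_continuous (V := R_NormedModule) (fun u : R => u ^ k)); auto_derive; auto. }
  rewrite continuous_eps in Hk; destruct (Hk (x - 1) ltac:(lra)) as [d Hd].
  pose proof (cond_pos d) as Hdp.
  set (e := Rmin (d / 2) (Rmin ((1 - r0) / 2) (1 / 2))).
  assert (0 < e) by (repeat apply Rmin_pos; lra).
  assert (e <= d / 2) by apply Rmin_l.
  assert (e <= Rmin ((1 - r0) / 2) (1 / 2)) by apply Rmin_r.
  pose proof (Rmin_l ((1 - r0) / 2) (1 / 2)); pose proof (Rmin_r ((1 - r0) / 2) (1 / 2)).
  specialize (H (1 - e) ltac:(lra) ltac:(lra)).
  assert (B : ball 1 d (1 - e)).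
  { change (Rabs (1 - e - 1) < d); apply Rabs_def1; lra. }
  specialize (Hd _ B); simpl in Hd; rewrite pow1 in Hd; apply Rabs_def2 in Hd; lra.
Qed.

Lemma Cmod_le_sqn (z w : C) : sqn z <= sqn w -> Cmod z <= Cmod w.
Proof.
  rewrite !sqn_Cmod; intros H; pose proof (Cmod_ge_0 z); pose proof (Cmod_ge_0 w); nra.
Qed.

(* Schwarz's lemma for [z^k q / (z^k q + beta)]; the factor [z^k] is removed by the
   maximum principle on circles of radius close to 1. *)
Lemma schwarz_half_plane (q : C -> C) (k : nat) (beta : R) :
  0 < beta -> holo2 q ->
  (forall z, Cmod z < 1 -> 0 < 2 * fst (z ^ k * q z)%C + beta) ->
  forall z, Cmod z < 1 -> Cmod (q z) <= Cmod (z ^ k * q z + RtoC beta)%C.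
Proof.
  intros Hb Hq Hpos z0 Hz0.
  set (den := fun z => (z ^ k * q z + RtoC beta)%C).
  assert (Hden : forall z, Cmod z < 1 -> den z <> 0%C).
  { intros z Hz E; specialize (Hpos z Hz); apply (f_equal fst) in E.
    unfold den in E; cbn [Cplus RtoC fst] in E; lra. }
  set (om := fun z => (q z * / den z)%C).
  assert (Hom : holo2 om).
  { apply holo2_mult; auto; apply holo2_inv; auto.
    apply holo2_plus; [apply holo2_mult; auto using holo2_pow | apply holo2_const]. }
  assert (Hle : forall z, Cmod z < 1 -> Cmod z ^ k * Cmod (om z) <= 1).
  { intros z Hz; unfold om; rewrite Cmod_mult, Cmod_inv by auto.
    pose proof (proj1 (Cmod_gt_0 _) (Hden z Hz)) as Hp.
    rewrite <- Rmult_assoc, <- Cmod_pow, <- Cmod_mult.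
    apply Rmult_le_reg_r with (Cmod (den z)); auto.
    rewrite Rmult_assoc, Rinv_l, Rmult_1_r, Rmult_1_l by lra.
    (* With [P = z^k q(z)], one has [|P + beta|^2 - |P|^2 = beta (2 Re P + beta)]. *)
    apply Cmod_le_sqn; specialize (Hpos z Hz); unfold den.
    destruct (z ^ k * q z)%C as [x y]; unfold sqn; simpl in *; nra. }
  assert (H1 : Cmod (om z0) <= 1).
  { destruct (unit_rotation (om z0)) as [e [He Hz]].
    apply pow_near_1 with k (Cmod z0); auto; intros rho R1 R2.
    assert (Hrk : 0 < rho ^ k) by (apply pow_lt; lra).
    replace (Cmod (om z0)) with (fst (e * om z0)%C) by now rewrite Hz.
    apply Rmult_le_reg_r with (/ rho ^ k); [now apply Rinv_0_lt_compat|].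
    rewrite Rmult_assoc, Rinv_r, Rmult_1_r, Rmult_1_l by lra.
    apply (max_principle (fun z => e * om z)%C rho); auto; [| | lra].
    - apply holo2_mult; auto using holo2_const.
    - intros z Ez; eapply Rle_trans; [apply Rle_abs|].
      eapply Rle_trans; [apply abs_fst_le_Cmod|]; rewrite Cmod_mult, He, Rmult_1_l.
      specialize (Hle z ltac:(lra)); rewrite Ez in Hle.
      apply Rmult_le_reg_l with (rho ^ k); auto; rewrite Rinv_r; lra. }
  fold (den z0); replace (q z0) with (om z0 * den z0)%C
    by (unfold om; field; now apply Hden).
  rewrite Cmod_mult; pose proof (Cmod_ge_0 (den z0)); nra.
Qed.

(** * Convex functions and their coefficients *)

(* With [beta = 2 (1 - alpha)], the last condition is [Re (1 + z h''/h') > alpha]. *)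
Definition convex_map (beta : R) (a : nat -> C) : Prop :=
  AC a /\ a 1%nat = 1%C /\ forall z, Cmod z < 1 ->
    PS (dcoef a) z <> 0%C /\
    0 < 2 * fst (z * PS (dcoef (dcoef a)) z / PS (dcoef a) z)%C + beta.

Lemma PS_INR_mul (c : nat -> C) (z : C) :
  AC c -> Cmod z < 1 -> PS (fun k => RtoC (INR k) * c k)%C z = (z * PS (dcoef c) z)%C.
Proof.
  intros Hc Hz; rewrite PS_unshift by auto using AC_INR_mul.
  simpl INR; rewrite Cmult_0_l, Cplus_0_l; reflexivity.
Qed.

Lemma PS_ext (c d : nat -> C) (z : C) : (forall k, c k = d k) -> PS c z = PS d z.
Proof. intros H; apply CSer_ext; intros k; now rewrite H. Qed.

Lemma dcoef_at_0 (beta : R) (a : nat -> C) : convex_map beta a -> (dcoef a 0%nat : C) = 1%C.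
Proof.
  intros [_ [H _]]; change (dcoef a 0%nat) with (RtoC (INR 1) * a 1%nat)%C.
  rewrite H; simpl; ring.
Qed.

(** Schwarz's lemma gives [|P| <= t |P + beta|] for [P = z h''/h']. This confines [P] to a disk
    whose leftmost point is [- beta t / (1 + t)]. *)
Lemma convex_pre_schwarzian (beta : R) (a : nat -> C) (z : C) (t : R) :
  0 < beta -> convex_map beta a -> Cmod z <= t -> t < 1 ->
  - beta * t / (1 + t) <= fst (z * PS (dcoef (dcoef a)) z / PS (dcoef a) z)%C.
Proof.
  intros Hb [Ha [Ha1 Hc]] Hz Ht.
  assert (Hz1 : Cmod z < 1) by lra; pose proof (Cmod_ge_0 z) as Hz0.
  set (q := fun z => (PS (dcoef (dcoef a)) z * / PS (dcoef a) z)%C).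
  assert (Hq : holo2 q).
  { apply holo2_mult; [apply holo2_PS; auto using AC_dcoef|].
    apply holo2_inv; [apply holo2_PS; auto using AC_dcoef | intros y Hy; now apply Hc]. }
  assert (S : Cmod (q z) <= Cmod (z ^ 1 * q z + RtoC beta)%C).
  { apply schwarz_half_plane; auto; intros y Hy; destruct (Hc y Hy) as [_ H].
    replace (y ^ 1 * q y)%C with (y * PS (dcoef (dcoef a)) y / PS (dcoef a) y)%C; auto.
    unfold q, Cdiv; simpl; ring. }
  replace (z * PS (dcoef (dcoef a)) z / PS (dcoef a) z)%C with (z * q z)%C
    by (unfold q, Cdiv; ring).
  replace (z ^ 1 * q z)%C with (z * q z)%C in S by (simpl; ring).
  set (P := (z * q z)%C) in *.
  assert (HP : Cmod P <= t * Cmod (P + RtoC beta)%C).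
  { unfold P at 1; rewrite Cmod_mult; apply Rmult_le_compat; auto using Cmod_ge_0. }
  assert (HP2 : sqn P <= t * t * sqn (P + RtoC beta)%C).
  { rewrite !sqn_Cmod; pose proof (Cmod_ge_0 P); nra. }
  destruct P as [x y]; unfold sqn in HP2; simpl in *.
  apply Rnot_lt_le; intros Hlt.
  assert (H1 : (1 + t) * x + beta * t < 0).
  { replace (- beta * t / (1 + t)) with (- (beta * t) / (1 + t)) in Hlt by (unfold Rdiv; ring).
    apply (Rmult_lt_compat_r (1 + t)) in Hlt; [| lra].
    unfold Rdiv in Hlt; rewrite Rmult_assoc, Rinv_l in Hlt; lra. }
  assert (H2 : (1 - t) * x - beta * t < 0) by nra.
  (* The disk inequality [HP2] says that this product plus [(1 - t^2) y^2] is at most 0, but left of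
     the smaller root both factors are negative. *)
  assert (0 < ((1 + t) * x + beta * t) * ((1 - t) * x - beta * t)) by nra.
  assert (0 <= (1 - t * t) * (y * y)) by (apply Rmult_le_pos; nra).
  nra.
Qed.

(** * Roots of unity and the coefficients of [z h''/h'] *)

Lemma Csum_exchange (f : nat -> nat -> C) (m n : nat) :
  Csum (fun i => Csum (fun j => f i j) n) m = Csum (fun j => Csum (fun i => f i j) m) n.
Proof.
  induction m as [|m IH]; simpl.
  - induction n as [|n IHn]; simpl; [reflexivity | rewrite <- IHn; ring].
  - rewrite IH, <- Csum_plus; reflexivity.
Qed.

Lemma Csum_const (c : C) (n : nat) : Csum (fun _ => c) n = (RtoC (INR n) * c)%C.
Proof.
  induction n as [|n IH]; [simpl; ring|].
  change (Csum (fun _ => c) (S n)) with (Csum (fun _ => c) n + c)%C.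
  rewrite IH, S_INR, RtoC_plus; ring.
Qed.

Lemma Csum_geom (x : C) (n : nat) : ((x - 1) * Csum (fun j => x ^ j) n = x ^ n - 1)%C.
Proof.
  induction n as [|n IH]; simpl; [ring|].
  rewrite Cmult_plus_distr_l, IH; ring.
Qed.

Lemma Cexpi_pow (x : R) (n : nat) : ((cos x, sin x) ^ n)%C = (cos (INR n * x), sin (INR n * x)).
Proof.
  induction n as [|n IH].
  - simpl; rewrite Rmult_0_l, cos_0, sin_0; reflexivity.
  - rewrite S_INR, Rmult_plus_distr_r, Rmult_1_l, cos_plus, sin_plus.
    change ((cos x, sin x) ^ S n)%C with ((cos x, sin x) * (cos x, sin x) ^ n)%C.
    rewrite IH; unfold Cmult; simpl; f_equal; ring.
Qed.

Lemma Cmod_Cexpi (x : R) : Cmod (cos x, sin x) = 1.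
Proof.
  unfold Cmod; simpl; rewrite !Rmult_1_r.
  pose proof (sin2_cos2 x) as H; unfold Rsqr in H.
  replace (cos x * cos x + sin x * sin x) with 1 by lra; apply sqrt_1.
Qed.

Lemma Cpow_one (n : nat) : (1 ^ n = 1)%C.
Proof. induction n as [|n IH]; simpl; [reflexivity | rewrite IH; ring]. Qed.

Lemma primitive_root_of_unity (k : nat) : (0 < k)%nat ->
  exists w : C, Cmod w = 1 /\ (w ^ k)%C = 1%C /\
    forall l, (0 < l < k)%nat -> Csum (fun j => (w ^ j) ^ l)%C k = 0%C.
Proof.
  intros Hk; apply lt_INR in Hk; simpl in Hk.
  set (x := 2 * PI / INR k).
  exists (cos x, sin x); pose proof PI_RGT_0.
  assert (Hw : ((cos x, sin x) ^ k)%C = 1%C).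
  { rewrite Cexpi_pow; replace (INR k * x) with (2 * PI) by (unfold x; field; lra).
    rewrite cos_2PI, sin_2PI; reflexivity. }
  split; [apply Cmod_Cexpi | split; [exact Hw|]].
  intros l [L1 L2]; set (w := (cos x, sin x)) in *.
  apply lt_INR in L1, L2; simpl in L1.
  rewrite (Csum_ext _ (fun j => (w ^ l) ^ j)%C).
  2: { intros j _; now rewrite <- !Cpow_mult_r, Nat.mul_comm. }
  assert (Hne : (w ^ l - 1 <> 0)%C).
  { unfold w; rewrite Cexpi_pow; intros E; apply (f_equal fst) in E; simpl in E.
    (* The half angle [y = PI l / k] lies strictly between 0 and PI, so [cos (2 y) = 1 - 2 sin^2 y]
       differs from 1. *)
    set (y := INR l * x / 2).
    replace (INR l * x) with (2 * y) in E by (unfold y; field).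
    rewrite cos_2a_sin in E.
    assert (0 < sin y).
    { assert (Hy : y = PI * (INR l / INR k)) by (unfold y, x; field; lra).
      assert (0 < INR l / INR k) by (apply Rdiv_lt_0_compat; lra).
      assert (INR l / INR k < 1).
      { apply Rmult_lt_reg_r with (INR k); [lra|].
        unfold Rdiv; rewrite Rmult_assoc, Rinv_l; lra. }
      apply sin_gt_0; rewrite Hy; nra. }
    nra. }
  pose proof (Csum_geom (w ^ l)%C k) as G.
  rewrite <- Cpow_mult_r, Nat.mul_comm, Cpow_mult_r, Hw, Cpow_one in G.
  replace (Csum (fun j => (w ^ l) ^ j)%C k)
    with ((w ^ l - 1) * Csum (fun j => (w ^ l) ^ j) k / (w ^ l - 1))%C by (field; auto).
  rewrite G; field; auto.
Qed.

(** [quotient_rem c K] is the series [R] in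
    [z h'' = h' (p_1 z + ... + p_K z^K) + z^(K+1) R], where [h' = sum c_k z^k];
    thus [p_(K+1)] is its constant term. *)
Fixpoint quotient_rem (c : nat -> C) (K : nat) : nat -> C :=
  match K with
  | O => dcoef c
  | S L => fun k => (quotient_rem c L (S k) - quotient_rem c L 0%nat * c (S k))%C
  end.

Lemma AC_quotient_rem (c : nat -> C) (K : nat) : AC c -> AC (quotient_rem c K).
Proof.
  intros Hc; induction K as [|K IH]; simpl; [now apply AC_dcoef|].
  pose proof (AC_plus _ _ (AC_shift _ IH)
    (AC_scal (- quotient_rem c K 0%nat)%C _ (AC_shift _ Hc))) as H.
  revert H; apply AC_le; intros k; right; f_equal; ring.
Qed.

Lemma quotient_rem_spec (c : nat -> C) (K : nat) (z : C) :
  AC c -> c 0%nat = 1%C -> Cmod z < 1 ->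
  (z * PS (dcoef c) z
   = PS c z * Csum (fun l => quotient_rem c l 0%nat * z ^ S l) K
     + z ^ S K * PS (quotient_rem c K) z)%C.
Proof.
  intros Hc Hc0 Hz; induction K as [|K IH]; [simpl; ring|].
  rewrite IH.
  change (Csum (fun l => quotient_rem c l 0%nat * z ^ S l)%C (S K)) with
    (Csum (fun l => quotient_rem c l 0%nat * z ^ S l) K + quotient_rem c K 0%nat * z ^ S K)%C.
  rewrite (PS_unshift (quotient_rem c K)) by auto using AC_quotient_rem.
  assert (E : PS (quotient_rem c (S K)) z =
    (PS (fun k => quotient_rem c K (S k)) z
     + - quotient_rem c K 0%nat * PS (fun k => c (S k)) z)%C).
  { rewrite <- PS_scal, <- PS_plus; auto using AC_scal, AC_shift, AC_quotient_rem.
    apply PS_ext; intros k; simpl; ring. }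
  rewrite E, (PS_unshift c z Hc Hz), Hc0.
  change (z ^ S (S K))%C with (z * z ^ S K)%C; ring.
Qed.

(** The recursion unrolled. At [k = 0] it compares the coefficients of [z h''] and [h' p]:
    [(K+1) c_(K+1)] is the sum of [p_(l+1) c_(K-l)] over [l <= K]. *)
Lemma quotient_rem_coef (c : nat -> C) (K k : nat) :
  (quotient_rem c K k
   = RtoC (INR (S (K + k))) * c (S (K + k))
     - Csum (fun l => quotient_rem c l 0%nat * c (K + k - l)%nat) K)%C.
Proof.
  revert k; induction K as [|K IH]; intros k.
  - change (quotient_rem c 0 k) with (RtoC (INR (S k)) * c (S k))%C; simpl Csum; simpl Nat.add; ring.
  - change (quotient_rem c (S K) k) with
      (quotient_rem c K (S k) - quotient_rem c K 0%nat * c (S k))%C.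
    rewrite (IH (S k)).
    change (Csum (fun l => quotient_rem c l 0%nat * c (S K + k - l)%nat)%C (S K)) with
      (Csum (fun l => quotient_rem c l 0%nat * c (S K + k - l)%nat) K
       + quotient_rem c K 0%nat * c (S K + k - K)%nat)%C.
    replace (K + S k)%nat with (S K + k)%nat by lia.
    replace (S K + k - K)%nat with (S k) by lia.
    ring.
Qed.

Lemma Cdiv_plus_mult (x y z w : C) : y <> 0%C -> x = (y * z + w)%C -> (x / y = z + w / y)%C.
Proof. intros Hy ->; field; auto. Qed.

Lemma fst_Csum_gt (u : nat -> C) (m : R) (n : nat) :
  (0 < n)%nat -> (forall j, m < fst (u j)) -> INR n * m < fst (Csum u n).
Proof.
  intros Hn H; induction n as [|n IH]; [lia|].
  rewrite S_INR; change (Csum u (S n)) with (Csum u n + u n)%C; simpl fst.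
  specialize (H n); destruct n as [|n]; [simpl; lra|].
  specialize (IH ltac:(lia)); lra.
Qed.

(* Caratheodory's coefficient bound: averaging [z h''/h'] over the rotations by the k-th
   roots of unity leaves [z^k q] with [q 0 = p_k], to which Schwarz's lemma applies. *)
Lemma quotient_coef_bound (beta : R) (a : nat -> C) (K : nat) :
  0 < beta -> convex_map beta a -> Cmod (quotient_rem (dcoef a) K 0%nat) <= beta.
Proof.
  intros Hb Hconv; pose proof (dcoef_at_0 _ _ Hconv) as Hc0.
  destruct Hconv as [Ha [Ha1 Hc]].
  set (c := dcoef a) in *; assert (Ac : AC c) by now apply AC_dcoef.
  set (k := S K).
  destruct (primitive_root_of_unity k ltac:(unfold k; lia)) as [w [Hw [Hwk Hsum]]].
  assert (Hwj : forall j, Cmod (w ^ j)%C = 1) by (intros j; rewrite Cmod_pow, Hw; apply pow1).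
  assert (Hk : 0 < INR k) by (apply lt_0_INR; unfold k; lia).
  set (S0 := fun z => (PS (quotient_rem c K) z * / PS c z)%C).
  assert (HS : holo2 S0).
  { apply holo2_mult; [apply holo2_PS; auto using AC_quotient_rem|].
    apply holo2_inv; [now apply holo2_PS | intros y Hy; now apply Hc]. }
  set (q := fun z => (RtoC (/ INR k) * Csum (fun j => S0 (w ^ j * z)) k)%C).
  assert (Hq : holo2 q).
  { apply holo2_mult; [apply holo2_const|]; apply holo2_Csum; intros j.
    apply holo2_scaled_arg; auto; rewrite Hwj; lra. }
  assert (Havg : forall z, Cmod z < 1 -> (z ^ k * q z
    = RtoC (/ INR k) * Csum (fun j => (w ^ j * z) * PS (dcoef c) (w ^ j * z) / PS c (w ^ j * z)) k)%C).
  { intros z Hz.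
    assert (Hj : forall j, Cmod (w ^ j * z)%C < 1)
      by (intros j; rewrite Cmod_mult, Hwj; lra).
    rewrite (Csum_ext _ (fun j => Csum (fun l => quotient_rem c l 0%nat * (w ^ j * z) ^ S l) K
                                  + z ^ k * S0 (w ^ j * z))%C).
    2: { intros j _; destruct (Hc _ (Hj j)) as [Hnz _].
         rewrite (Cdiv_plus_mult _ _ _ _ Hnz (quotient_rem_spec c K _ Ac Hc0 (Hj j))).
         fold k; rewrite Cpow_mult_l, <- Cpow_mult_r, Nat.mul_comm, Cpow_mult_r, Hwk, Cpow_one.
         unfold S0, Cdiv; ring. }
    (* The terms of degree 1 to [K = k - 1] average to zero over the [k]-th roots of unity; the
       remainder is unaffected in its factor [z^k] because [w^k = 1]. *)
    rewrite Csum_plus, Csum_exchange, (Csum_ext _ (fun _ => 0%C)).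
    2: { intros l Hl.
         rewrite (Csum_ext _ (fun j => (quotient_rem c l 0%nat * z ^ S l) * (w ^ j) ^ S l)%C)
           by (intros j _; rewrite Cpow_mult_l; ring).
         rewrite Csum_scal, Hsum by (unfold k; lia); ring. }
    rewrite Csum_const, Csum_scal; unfold q; ring. }
  assert (Hpos : forall z, Cmod z < 1 -> 0 < 2 * fst (z ^ k * q z)%C + beta).
  { intros z Hz; rewrite Havg by auto.
    set (u := fun j => ((w ^ j * z) * PS (dcoef c) (w ^ j * z) / PS c (w ^ j * z))%C).
    assert (G : INR k * (- beta / 2) < fst (Csum u k)).
    { apply fst_Csum_gt; [unfold k; lia|]; intros j.
      assert (Hj : Cmod (w ^ j * z)%C < 1) by (rewrite Cmod_mult, Hwj; lra).
      destruct (Hc _ Hj) as [_ H]; unfold u; lra. }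
    assert (E : fst (RtoC (/ INR k) * Csum u k)%C = / INR k * fst (Csum u k)) by (simpl; ring).
    rewrite E; apply (Rmult_lt_compat_l (/ INR k)) in G; [| now apply Rinv_0_lt_compat].
    rewrite <- Rmult_assoc, Rinv_l in G; lra. }
  assert (Z0 : Cmod 0%C < 1) by (rewrite Cmod_0; lra).
  (* At the origin [z^k q(z)] vanishes, so the right side of Schwarz's bound is exactly [beta]. *)
  pose proof (schwarz_half_plane q k beta Hb Hq Hpos 0%C Z0) as S.
  assert (Eq : q 0%C = quotient_rem c K 0%nat).
  { unfold q; rewrite (Csum_ext _ (fun _ => quotient_rem c K 0%nat)).
    - rewrite Csum_const, Cmult_assoc, <- RtoC_mult, Rinv_l by lra; ring.
    - intros j _; unfold S0; rewrite Cmult_0_r, !PS_0, Hc0 by auto using AC_quotient_rem.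
      field. }
  rewrite Eq in S; unfold k in S; simpl in S.
  rewrite !Cmult_0_l, Cplus_0_l, Cmod_R, Rabs_pos_eq in S; lra.
Qed.

(** * Majorant of the coefficients of [h'] *)

(** [beta (beta + 1) ... (beta + k - 1) / k!], the Taylor coefficients of [(1 - x)^(-beta)], the
    derivative of the extremal function. *)
Fixpoint maj (beta : R) (k : nat) : R :=
  match k with O => 1 | S p => maj beta p * (beta + INR p) / INR (S p) end.

Fixpoint Rsum (u : nat -> R) (n : nat) : R :=
  match n with O => 0 | S p => Rsum u p + u p end.

(** Coefficient form of [x y' = (beta x / (1 - x)) y] for [y = (1 - x)^(-beta)]: the case of
    equality in the recursive estimate of [convex_coef_bound]. *)
Lemma maj_rec (beta : R) (k : nat) : beta * Rsum (maj beta) k = INR k * maj beta k.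
Proof.
  induction k as [|k IH]; [simpl; ring|].
  simpl Rsum; rewrite Rmult_plus_distr_l, IH.
  change (maj beta (S k)) with (maj beta k * (beta + INR k) / INR (S k)).
  field; apply not_0_INR; lia.
Qed.

Lemma Rsum_le (u v : nat -> R) (n : nat) :
  (forall k, (k < n)%nat -> u k <= v k) -> Rsum u n <= Rsum v n.
Proof.
  induction n as [|n IH]; intros H; simpl; [lra|].
  pose proof (H n ltac:(lia)); assert (Rsum u n <= Rsum v n) by (apply IH; auto); lra.
Qed.

Lemma Rsum_rev (u : nat -> R) (n : nat) : Rsum (fun l => u (n - S l)%nat) n = Rsum u n.
Proof.
  revert u; induction n as [|n IH]; intros u; [reflexivity|].
  assert (E : forall u m, Rsum u (S m) = u 0%nat + Rsum (fun l => u (S l)) m).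
  { clear; intros u m; induction m as [|m IH]; [simpl; ring|].
    change (Rsum u (S (S m))) with (Rsum u (S m) + u (S m)).
    rewrite IH; simpl; ring. }
  rewrite E; simpl Nat.sub; rewrite Nat.sub_0_r.
  rewrite IH; simpl; ring.
Qed.

Lemma Cmod_Csum_le (u : nat -> C) (n : nat) :
  Cmod (Csum u n) <= Rsum (fun k => Cmod (u k)) n.
Proof.
  induction n as [|n IH]; [simpl; rewrite Cmod_0; lra|].
  eapply Rle_trans; [apply Cmod_triangle|]; apply Rplus_le_compat_r, IH.
Qed.

(** Since every [|p_l| <= beta], the recursion gives [k |c_k| <= beta (|c_0| + ... + |c_(k-1)|)],
    and [maj] satisfies this with equality. *)
Lemma convex_coef_bound (beta : R) (a : nat -> C) (k : nat) :
  0 < beta -> convex_map beta a -> Cmod (dcoef a k) <= maj beta k.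
Proof.
  intros Hb Hconv; pose proof (dcoef_at_0 _ _ Hconv) as Hc0.
  induction k as [k IH] using (well_founded_induction Wf_nat.lt_wf).
  destruct k as [|K]; [rewrite Hc0, Cmod_1; simpl; lra|].
  set (c := dcoef a) in *.
  assert (E : (RtoC (INR (S K)) * c (S K)
    = Csum (fun l => quotient_rem c l 0%nat * c (K - l)%nat) (S K))%C).
  { pose proof (quotient_rem_coef c K 0) as H; rewrite Nat.add_0_r in H.
    change (Csum (fun l => quotient_rem c l 0%nat * c (K - l)%nat)%C (S K)) with
      (Csum (fun l => quotient_rem c l 0%nat * c (K - l)%nat) K
       + quotient_rem c K 0%nat * c (K - K)%nat)%C.
    rewrite Nat.sub_diag, Hc0, H; ring. }
  assert (HS : 0 < INR (S K)) by (apply lt_0_INR; lia).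
  apply Rmult_le_reg_l with (INR (S K)); auto.
  rewrite <- maj_rec, <- (Rabs_pos_eq (INR (S K))), <- Cmod_R, <- Cmod_mult, E by lra.
  eapply Rle_trans; [apply Cmod_Csum_le|].
  rewrite <- (Rsum_rev (maj beta)).
  assert (D : forall u n, Rsum (fun l => beta * u l) n = beta * Rsum u n).
  { clear; intros u n; induction n as [|n IH]; simpl; [ring | rewrite IH; ring]. }
  rewrite <- D; apply Rsum_le; intros l Hl; rewrite Cmod_mult.
  apply Rmult_le_compat; auto using Cmod_ge_0.
  - now apply quotient_coef_bound.
  - simpl Nat.sub; apply IH; lia.
Qed.

(** * Two-point distortion *)

Lemma sqn_pos (z : C) : z <> 0%C -> 0 < sqn z.
Proof. intros H; rewrite sqn_Cmod; apply Cmod_gt_0 in H; nra. Qed.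

Lemma fst_Cdiv (z w : C) : w <> 0%C -> fst (z / w)%C * sqn w = fst (z * Cconj w)%C.
Proof.
  intros H; apply sum_sqr_neq_0 in H; destruct z as [x y], w as [u v].
  unfold sqn; simpl in *; field; lra.
Qed.

Lemma is_derive_neg_decr (u : R -> R) (l d : R) :
  is_derive u 0 l -> l < 0 -> 0 < d -> exists s, 0 < s < d /\ u s < u 0.
Proof.
  intros Hu Hl Hd; apply is_derive_Reals in Hu.
  destruct (Hu (- l) ltac:(lra)) as [e He]; pose proof (cond_pos e) as Hep.
  set (s := Rmin d e / 2).
  assert (0 < Rmin d e) by (apply Rmin_pos; auto).
  pose proof (Rmin_l d e); pose proof (Rmin_r d e).
  assert (Hs : 0 < s /\ s < d /\ s < e) by (unfold s; lra); destruct Hs as [S1 [S2 S3]].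
  exists s; split; [lra|].
  assert (B : Rabs s < e) by (rewrite Rabs_pos_eq; lra).
  specialize (He s ltac:(lra) B).
  rewrite Rplus_0_l in He; apply Rabs_def2 in He.
  assert (Q : (u s - u 0) / s < 0) by lra.
  assert (u s - u 0 < 0); [| lra].
  replace (u s - u 0) with ((u s - u 0) / s * s) by (field; lra); nra.
Qed.

(* At a minimum over [|z| <= |z0|] of the real part of
   [G = (f z - f w) / (a z - a w)], where [f' = psi a'], moving [z] in the direction
   [- (a z0 - a w) / a'(z0)], which points into the disk when [Re X > 0], changes
   [Re G] at the rate [- Re (psi z0 - G)]. *)
Lemma ratio_min_point (a f : nat -> C) (z0 w : C) (psi : C) :
  AC a -> AC f -> Cmod z0 < 1 -> Cmod w < 1 -> z0 <> w -> QS a z0 w <> 0%C ->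
  PS (dcoef a) z0 <> 0%C ->
  PS (dcoef f) z0 = (psi * PS (dcoef a) z0)%C ->
  0 < fst (z0 * PS (dcoef a) z0 / (PS a z0 - PS a w))%C ->
  (forall z, Cmod z <= Cmod z0 ->
     fst (QS f z0 w / QS a z0 w)%C <= fst (QS f z w / QS a z w)%C) ->
  fst psi <= fst (QS f z0 w / QS a z0 w)%C.
Proof.
  intros Ha Hf Hz Hw Hne HQ HH1 Hpsi HX Hmin.
  set (H1 := PS (dcoef a) z0) in *.
  set (D := (PS a z0 - PS a w)%C) in *.
  assert (Hzw : (z0 - w <> 0)%C) by now apply Cminus_eq_contra.
  assert (HDE : D = ((z0 - w) * QS a z0 w)%C) by (unfold D; now rewrite QS_mul).
  assert (HD : D <> 0%C) by (rewrite HDE; now apply Cmult_neq_0).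
  set (X := (z0 * H1 / D)%C) in *.
  set (G := fun z => ((PS f z + - PS f w) * / (PS a z + - PS a w))%C).
  assert (HG : forall z, Cmod z < 1 -> z <> w -> QS a z w <> 0%C ->
    G z = (QS f z w / QS a z w)%C).
  { intros z Hz' Hn HQ'; unfold G.
    replace (PS f z + - PS f w)%C with (PS f z - PS f w)%C by ring.
    replace (PS a z + - PS a w)%C with (PS a z - PS a w)%C by ring.
    rewrite <- !QS_mul by auto.
    assert ((z - w <> 0)%C) by now apply Cminus_eq_contra.
    field; auto. }
  apply Rnot_lt_le; intros Hlt; rewrite <- HG in Hlt by auto.
  set (v := (- D / H1)%C).
  assert (Hd : cderiv G z0 ((psi - G z0) * H1 / D)%C).
  { assert (Da : cderiv (fun z => PS a z + - PS a w)%C z0 (H1 + 0)%C).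
    { apply cderiv_plus; [now apply cderiv_PS | apply cderiv_const]. }
    assert (Df : cderiv (fun z => PS f z + - PS f w)%C z0 (PS (dcoef f) z0 + 0)%C).
    { apply cderiv_plus; [now apply cderiv_PS | apply cderiv_const]. }
    assert (HD' : (PS a z0 + - PS a w)%C = D) by (unfold D; ring).
    apply cderiv_inv in Da; [| now rewrite HD'].
    pose proof (cderiv_mult _ _ _ _ _ Df Da) as M.
    eapply cderiv_eq; [| exact M].
    unfold G; rewrite HD', Hpsi; fold H1; field; auto. }
  assert (Hz0 : (z0 + RtoC 0 * v)%C = z0) by ring.
  assert (Hder : is_derive (fun s => fst (G (z0 + RtoC s * v)%C)) 0 (- (fst psi - fst (G z0)))).
  { replace (- (fst psi - fst (G z0))) with (fst ((psi - G z0) * H1 / D * v)%C).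
    - apply cderiv_line; now rewrite Hz0.
    - replace ((psi - G z0) * H1 / D * v)%C with (- (psi - G z0))%C
        by (unfold v; field; auto).
      simpl; ring. }
  assert (Hdir : fst (Cconj z0 * v)%C < 0).
  { assert (HXne : X <> 0%C) by (intros E; rewrite E in HX; simpl in HX; lra).
    assert (Hz00 : z0 <> 0%C) by (intros E; apply HXne; unfold X, Cdiv; rewrite E; ring).
    assert (Ev : (Cconj z0 * v = RtoC (sqn z0) * (- (1) / X))%C).
    { replace (RtoC (sqn z0)) with (Cconj z0 * z0)%C.
      - unfold v, X; field; auto.
      - destruct z0; unfold sqn, Cmult, Cconj, RtoC; simpl; f_equal; ring. }
    rewrite Ev.
    pose proof (fst_Cdiv (- (1)) X HXne) as E.
    pose proof (sqn_pos X HXne); pose proof (sqn_pos z0 Hz00).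
    replace (fst (RtoC (sqn z0) * (- (1) / X))%C) with (sqn z0 * fst (- (1) / X)%C)
      by (simpl; ring).
    assert (fst (- (1) * Cconj X)%C = - fst X) by (simpl; ring).
    assert (fst (- (1) / X)%C < 0); nra. }
  assert (Hvp : 0 < sqn v).
  { apply sqn_pos; intros E; rewrite E in Hdir; simpl in Hdir; lra. }
  set (p := fst (Cconj z0 * v)%C) in *.
  assert (HQn : exists d, 0 < d /\ forall s, 0 < s < d -> (z0 + RtoC s * v)%C <> w /\
            QS a (z0 + RtoC s * v)%C w <> 0%C /\ Cmod (z0 + RtoC s * v)%C < 1).
  { assert (C1 : ccont (fun s : R => (z0 + RtoC s * v) + - w)%C 0).
    { apply ccont_plus; [apply ccont_line | apply ccont_const]. }
    assert (C2 : ccont (fun s : R => QS a (z0 + RtoC s * v)%C w) 0).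
    { apply ccont_QS; auto using ccont_const; [apply ccont_line | now rewrite Hz0]. }
    apply ccont_neq_0 in C1; [| rewrite Hz0; exact Hzw].
    apply ccont_neq_0 in C2; [| now rewrite Hz0].
    assert (C3 := ccont_Cmod_lt _ _ 1 (ccont_line z0 v 0)); cbv beta in C3; rewrite Hz0 in C3.
    destruct (locally_and C1 (locally_and C2 (C3 Hz))) as [d Hd'].
    exists d; split; [apply cond_pos|]; intros s Hs.
    destruct (Hd' s) as [A1 [A2 A3]].
    - change (Rabs (s - 0) < d); rewrite Rabs_pos_eq; lra.
    - split; [| auto]; intros E; apply A1; rewrite E; ring. }
  destruct HQn as [d [Hdp HQn]].
  (* From [|z0 + s v|^2 = |z0|^2 + s (2 p + s |v|^2)], steps shorter than [- 2 p / |v|^2] stay in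
     the disk [|z| <= |z0|]. *)
  destruct (is_derive_neg_decr _ _ (Rmin d (- 2 * p / sqn v)) Hder) as [s [Hs Hdec]];
    [lra | apply Rmin_pos; auto; apply Rdiv_lt_0_compat; lra |].
  pose proof (Rmin_l d (- 2 * p / sqn v)); pose proof (Rmin_r d (- 2 * p / sqn v)).
  destruct (HQn s ltac:(lra)) as [A1 [A2 A3]].
  rewrite Hz0, !HG in Hdec by auto.
  assert (Hle : Cmod (z0 + RtoC s * v)%C <= Cmod z0).
  { apply Cmod_le_sqn.
    replace (sqn (z0 + RtoC s * v)%C) with (sqn z0 + s * (2 * p + s * sqn v))
      by (unfold p, sqn; destruct z0, v; simpl; ring).
    assert (s * sqn v < - 2 * p).
    { replace (- 2 * p) with (- 2 * p / sqn v * sqn v) by (field; lra).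
      apply Rmult_lt_compat_r; lra. }
    nra. }
  specialize (Hmin _ Hle); lra.
Qed.

(* [Re (log-derivative of s -> a(sz) - a(sw))], up to the factor [|QS a z w|^2 / s]. *)
Definition radial (a : nat -> C) (z w : C) : R :=
  fst (QS (fun k => RtoC (INR k) * a k)%C z w * Cconj (QS a z w))%C.

Lemma radial_QS_neq_0 (a : nat -> C) (z w : C) : 0 < radial a z w -> QS a z w <> 0%C.
Proof. intros H E; unfold radial in H; rewrite E in H; simpl in H; lra. Qed.

(** Used with [f = z h'] for the first inequality and with [f = h + u g] for the second. The
    assumption [radial > 0] keeps the quotient continuous and ensures that at a minimum at least one
    variable can be moved. *)
Lemma ratio_lower_bound (a f : nat -> C) (psi : C -> C) (t kappa : R) :
  AC a -> AC f -> 0 <= t < 1 ->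
  (forall z, Cmod z <= t -> PS (dcoef a) z <> 0%C /\
     PS (dcoef f) z = (psi z * PS (dcoef a) z)%C /\ kappa <= fst (psi z)) ->
  (forall z w, Cmod z <= t -> Cmod w <= t -> 0 < radial a z w) ->
  forall z w, Cmod z <= t -> Cmod w <= t -> kappa <= fst (QS f z w / QS a z w)%C.
Proof.
  intros Ha Hf Ht Hpsi Hrad z1 w1 Hz1 Hw1.
  assert (HQ : forall z w, Cmod z <= t -> Cmod w <= t -> QS a z w <> 0%C).
  { intros z w Hz Hw; apply radial_QS_neq_0; auto. }
  destruct (bidisk_min (fun p => fst (QS f (fst p) (snd p) / QS a (fst p) (snd p))%C) t)
    as [[z w] [[Hz Hw] Hmin]]; [lra | |].
  { intros p [P1 P2]; apply ccont_fst, ccont_mult; [| apply ccont_inv; auto];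
      apply ccont_QS; auto using ccont_CC_fst, ccont_CC_snd; lra. }
  simpl in Hz, Hw.
  assert (Hmin' : forall x y, Cmod x <= t -> Cmod y <= t ->
    fst (QS f z w / QS a z w)%C <= fst (QS f x y / QS a x y)%C).
  { intros x y Hx Hy; exact (Hmin (x, y) (conj Hx Hy)). }
  apply Rle_trans with (2 := Hmin' z1 w1 Hz1 Hw1).
  destruct (Hpsi z Hz) as [N1 [E1 K1]], (Hpsi w Hw) as [N2 [E2 K2]].
  destruct (Ceq_dec z w) as [<- | Hne].
  { rewrite !QS_diag, E1 by (auto; lra).
    replace (psi z * PS (dcoef a) z / PS (dcoef a) z)%C with (psi z) by (field; auto); lra. }
  assert (Hzw : (z - w <> 0)%C) by now apply Cminus_eq_contra.
  set (X := (z * PS (dcoef a) z / (PS a z - PS a w))%C).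
  set (Y := (w * PS (dcoef a) w / (PS a w - PS a z))%C).
  (* [X + Y] is the quotient [(z h'(z) - w h'(w)) / (h z - h w)], whose real part has the sign of
     [radial]. *)
  assert (HXY : 0 < fst X + fst Y).
  { assert (E : (X + Y = QS (fun k => RtoC (INR k) * a k) z w / QS a z w)%C).
    { specialize (HQ z w Hz Hw).
      pose proof (QS_mul (fun k => RtoC (INR k) * a k)%C z w (AC_INR_mul _ Ha)
        ltac:(lra) ltac:(lra)) as M.
      rewrite !PS_INR_mul in M by (auto; lra).
      unfold X, Y; replace (PS a w - PS a z)%C with (- (PS a z - PS a w))%C by ring.
      rewrite <- QS_mul by (auto; lra).
      replace (QS (fun k => RtoC (INR k) * a k)%C z w)
        with ((z * PS (dcoef a) z - w * PS (dcoef a) w) / (z - w))%C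
        by (rewrite <- M; field; auto).
      field; auto. }
    change (fst X + fst Y) with (fst (X + Y)%C); rewrite E.
    pose proof (sqn_pos _ (HQ z w Hz Hw)) as S.
    pose proof (fst_Cdiv (QS (fun k => RtoC (INR k) * a k)%C z w) _ (HQ z w Hz Hw)) as F.
    specialize (Hrad z w Hz Hw); unfold radial in Hrad; rewrite <- F in Hrad; nra. }
  destruct (Rlt_le_dec 0 (fst X)) as [HX | HX].
  - apply Rle_trans with (1 := K1).
    apply (ratio_min_point a f z w (psi z)); auto; try lra.
    intros y Hy; apply Hmin'; lra.
  - apply Rle_trans with (1 := K2).
    rewrite (QS_sym f), (QS_sym a).
    apply (ratio_min_point a f w z (psi w)); auto; try lra.
    + fold Y; lra.
    + intros y Hy; rewrite (QS_sym f w z), (QS_sym a w z); apply Hmin'; lra.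
Qed.

Lemma PS_dcoef_INR_mul (a : nat -> C) (z : C) : AC a -> Cmod z < 1 ->
  PS (dcoef (fun k => RtoC (INR k) * a k)%C) z
  = (PS (dcoef a) z + z * PS (dcoef (dcoef a)) z)%C.
Proof.
  intros Ha Hz; rewrite <- PS_INR_mul, <- PS_plus by auto using AC_INR_mul, AC_dcoef.
  apply PS_ext; intros k.
  change (RtoC (INR (S k)) * (RtoC (INR (S k)) * a (S k))
    = RtoC (INR (S k)) * a (S k) + RtoC (INR k) * (RtoC (INR (S k)) * a (S k)))%C.
  rewrite (S_INR k), RtoC_plus; ring.
Qed.

(** Lower bound of [Re (1 + z h''/h')] on [|z| <= t]. *)
Definition kap (beta t : R) : R := 1 - beta * t / (1 + t).

Lemma convex_psi (beta : R) (a : nat -> C) (z : C) (t : R) :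
  0 < beta -> convex_map beta a -> Cmod z <= t -> t < 1 ->
  let psi := (1 + z * PS (dcoef (dcoef a)) z / PS (dcoef a) z)%C in
  PS (dcoef a) z <> 0%C /\
  PS (dcoef (fun k => RtoC (INR k) * a k)%C) z = (psi * PS (dcoef a) z)%C /\
  kap beta t <= fst psi.
Proof.
  intros Hb Hconv Hz Ht psi.
  pose proof (convex_pre_schwarzian beta a z t Hb Hconv Hz Ht) as HP.
  destruct Hconv as [Ha [Ha1 Hc]]; destruct (Hc z ltac:(lra)) as [HN _].
  split; [auto | split].
  - rewrite PS_dcoef_INR_mul by (auto; lra); unfold psi; field; auto.
  - unfold psi, kap; cbn [fst Cplus RtoC].
    replace (beta * t / (1 + t)) with (- (- beta * t / (1 + t))) by (unfold Rdiv; ring); lra.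
Qed.

(** From [beta <= 2], that is [alpha >= 0], the numerator [1 + t - beta t] is at least [1 - t]. *)
Lemma kap_pos (beta t : R) : 0 < beta <= 2 -> 0 <= t < 1 -> 0 < kap beta t.
Proof.
  intros Hb Ht; unfold kap.
  replace (1 - beta * t / (1 + t)) with ((1 + t - beta * t) / (1 + t)) by (field; lra).
  apply Rdiv_lt_0_compat; nra.
Qed.

Lemma radial_diag (beta : R) (a : nat -> C) (z : C) :
  0 < beta <= 2 -> convex_map beta a -> Cmod z < 1 -> 0 < radial a z z.
Proof.
  intros Hb Hconv Hz.
  destruct (convex_psi beta a z (Cmod z) ltac:(lra) Hconv ltac:(lra) Hz) as [N [E K]].
  pose proof (kap_pos beta (Cmod z) Hb (conj (Cmod_ge_0 z) Hz)) as KP.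
  destruct Hconv as [Ha _].
  unfold radial; rewrite !QS_diag, E by auto using AC_INR_mul.
  pose proof (sqn_pos _ N) as S; unfold sqn in S.
  set (psi := (1 + z * PS (dcoef (dcoef a)) z / PS (dcoef a) z)%C) in *.
  set (H := PS (dcoef a) z) in *.
  replace (fst (psi * H * Cconj H)%C) with (fst psi * sqn H)
    by (unfold sqn; destruct psi, H; simpl; ring).
  unfold sqn; apply Rmult_lt_0_compat; lra.
Qed.

(** * Growth of differences along rays from the origin *)

Lemma ccont_ray (z : C) (s : R) : ccont (fun s : R => RtoC s * z)%C s.
Proof.
  apply ccont_mult; [| apply ccont_const].
  apply ccont_components; split; simpl; [apply continuous_id | apply continuous_const].
Qed.

Lemma Cmod_ray (z : C) (s : R) : 0 <= s -> Cmod (RtoC s * z)%C = s * Cmod z.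
Proof. intros H; now rewrite Cmod_mult, Cmod_R, Rabs_pos_eq. Qed.

Lemma is_derive_PS_ray (a : nat -> C) (z e : C) (s : R) :
  AC a -> Cmod (RtoC s * z)%C < 1 ->
  is_derive (fun s => fst (e * PS a (RtoC s * z))%C) s
    (fst (e * (z * PS (dcoef a) (RtoC s * z)))%C).
Proof.
  intros Ha Hs.
  apply is_derive_ext with (fun s => fst (e * PS a (0 + RtoC s * z))%C).
  { intros t; now rewrite Cplus_0_l. }
  replace (fst (e * (z * PS (dcoef a) (RtoC s * z)))%C) with
    (fst ((0 * PS a (0 + RtoC s * z) + e * PS (dcoef a) (0 + RtoC s * z)) * z)%C)
    by (rewrite Cplus_0_l; f_equal; ring).
  apply (cderiv_line (fun y => e * PS a y)%C).
  apply (cderiv_mult (fun _ => e) (PS a)); [apply cderiv_const|].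
  apply cderiv_PS; auto; now rewrite Cplus_0_l.
Qed.

Lemma is_derive_sqn_ray (a : nat -> C) (z w : C) (s : R) :
  AC a -> 0 < s -> s * Cmod z < 1 -> s * Cmod w < 1 ->
  is_derive (fun s => sqn (PS a (RtoC s * z) - PS a (RtoC s * w))%C) s
    (2 * s * sqn (z - w)%C * radial a (RtoC s * z)%C (RtoC s * w)%C).
Proof.
  intros Ha Hs Hz Hw; rewrite <- Cmod_ray in Hz, Hw by lra.
  set (N := fun s e => fst (e * PS a (RtoC s * z) + - e * PS a (RtoC s * w))%C).
  set (N' := fun e => fst (e * (z * PS (dcoef a) (RtoC s * z))
                           + - e * (w * PS (dcoef a) (RtoC s * w)))%C).
  assert (HN : forall e, is_derive (fun s => N s e) s (N' e)).
  { intros e; apply (is_derive_plus (V := R_NormedModule)); now apply is_derive_PS_ray. }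
  (* For [e = 1] and [e = i], [N s e] is the real part and minus the imaginary part of the
     difference. *)
  apply is_derive_ext with (fun s => N s 1%C * N s 1%C + N s Ci * N s Ci).
  { intros t; unfold N, sqn; destruct (PS a (RtoC t * z)), (PS a (RtoC t * w)); simpl; ring. }
  replace (2 * s * sqn (z - w)%C * radial a (RtoC s * z)%C (RtoC s * w)%C) with
    ((N' 1%C * N s 1%C + N s 1%C * N' 1%C) + (N' Ci * N s Ci + N s Ci * N' Ci)).
  { apply (is_derive_plus (V := R_NormedModule));
      apply (is_derive_mult (K := R_AbsRing)); auto; intros; apply Rmult_comm. }
  pose proof (QS_mul a _ _ Ha Hz Hw) as M1.
  pose proof (QS_mul _ _ _ (AC_INR_mul _ Ha) Hz Hw) as M2.
  rewrite !PS_INR_mul in M2 by auto.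
  set (x := PS a (RtoC s * z)) in *; set (y := PS a (RtoC s * w)) in *.
  set (x' := PS (dcoef a) (RtoC s * z)) in *; set (y' := PS (dcoef a) (RtoC s * w)) in *.
  unfold radial.
  set (Q := QS a (RtoC s * z) (RtoC s * w)) in *.
  set (P := QS (fun k => RtoC (INR k) * a k)%C (RtoC s * z) (RtoC s * w)) in *.
  assert (E : (N' 1%C * N s 1%C + N s 1%C * N' 1%C) + (N' Ci * N s Ci + N s Ci * N' Ci)
    = 2 * fst ((z * x' - w * y') * Cconj (x - y))%C).
  { unfold N, N'; fold x y x' y'; destruct x, y, x', y', z, w; simpl; ring. }
  rewrite E.
  (* The extra factor [s] turns [z h'(s z)] into [(s z) h'(s z)], to which [QS_mul] applies. *)
  apply Rmult_eq_reg_l with s; [| lra].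
  replace (s * (2 * fst ((z * x' - w * y') * Cconj (x - y))%C)) with
    (2 * fst ((RtoC s * z * x' - RtoC s * w * y') * Cconj (x - y))%C)
    by (destruct x, y, x', y', z, w; simpl; ring).
  rewrite <- M1, <- M2; unfold sqn; destruct P, Q, z, w; simpl; ring.
Qed.

(* Continuity method in the radius [t]: as long as [radial > 0] on the open bidisk,
   [ratio_lower_bound] keeps it away from 0, while [|a(sz) - a(sw)|] increases in [s]. *)
Lemma radial_pos (beta : R) (a : nat -> C) (z w : C) :
  0 < beta <= 2 -> convex_map beta a -> Cmod z < 1 -> Cmod w < 1 -> 0 < radial a z w.
Proof.
  intros Hb Hconv Hz1 Hw1; assert (Ha : AC a) by apply Hconv.
  apply Rnot_le_lt; intros Hbad.
  set (good := fun t => forall x y, Cmod x <= t -> Cmod y <= t -> 0 < radial a x y).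
  set (r1 := Rmax (Cmod z) (Cmod w)).
  assert (Hr1 : r1 < 1) by now apply Rmax_lub_lt.
  assert (Hzr : Cmod z <= r1) by apply Rmax_l; assert (Hwr : Cmod w <= r1) by apply Rmax_r.
  assert (Hnr1 : ~ good r1) by (intros H; specialize (H z w Hzr Hwr); lra).
  pose proof (Cmod_ge_0 z) as Hz0.
  set (T := fun t => 0 <= t <= r1 /\ good t).
  assert (HT0 : T 0).
  { split; [lra|]; intros x y Hx Hy.
    assert (x = 0%C) by (apply Cmod_eq_0; pose proof (Cmod_ge_0 x); lra).
    assert (y = 0%C) by (apply Cmod_eq_0; pose proof (Cmod_ge_0 y); lra).
    subst; apply radial_diag with beta; auto; rewrite Cmod_0; lra. }
  destruct (completeness T) as [ts [Hub Hlub]].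
  { exists r1; intros t [[_ H] _]; exact H. }
  { now exists 0. }
  assert (Hts0 : 0 <= ts) by now apply Hub.
  assert (Hts1 : ts <= r1) by (apply Hlub; intros t [[_ H] _]; exact H).
  assert (Hlt : forall t, t < ts -> good t).
  { intros t Ht; apply NNPP; intros Hn.
    assert (ts <= t); [| lra].
    apply Hlub; intros t' [_ Ht']; apply Rnot_lt_le; intros Hc.
    apply Hn; intros x y Hx Hy; apply Ht'; lra. }
  (* The set of good radii is closed: points of the closed bidisk of radius [ts] are limits, as [s]
     tends to 1, of [(s x, s y)] in smaller bidisks, where the estimate with the fixed constant
     [kap beta ts] holds. *)
  assert (Hgood : good ts).
  { intros x y Hx Hy.
    destruct (Ceq_dec x y) as [<- | Hne]; [apply radial_diag with beta; auto; lra|].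
    assert (Hts : 0 < ts).
    { destruct (Rle_lt_or_eq_dec _ _ Hts0) as [|E]; auto; exfalso; apply Hne.
      pose proof (Cmod_ge_0 x); pose proof (Cmod_ge_0 y).
      transitivity (RtoC 0); [| symmetry]; apply Cmod_eq_0; lra. }
    pose proof (kap_pos beta ts Hb ltac:(lra)) as Hk.
    assert (Hin : forall s, 0 < s < 1 ->
      Cmod (RtoC s * x)%C <= s * ts /\ Cmod (RtoC s * y)%C <= s * ts /\ s * ts < ts).
    { intros s Hs; rewrite !Cmod_ray by lra; repeat split; nra. }
    assert (Hrad : forall s, 0 < s < 1 -> 0 < radial a (RtoC s * x)%C (RtoC s * y)%C).
    { intros s Hs; destruct (Hin s Hs) as [A1 [A2 A3]]; now apply (Hlt (s * ts)). }
    assert (Hs : forall s, 0 < s < 1 ->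
      kap beta ts * sqn (QS a (RtoC s * x) (RtoC s * y)) <= radial a (RtoC s * x)%C (RtoC s * y)%C).
    { intros s Hs; destruct (Hin s Hs) as [A1 [A2 A3]].
      assert (HQ := radial_QS_neq_0 _ _ _ (Hrad s Hs)).
      unfold radial; rewrite <- fst_Cdiv by auto.
      apply Rmult_le_compat_r; [left; now apply sqn_pos|].
      apply (ratio_lower_bound a _
        (fun z => 1 + z * PS (dcoef (dcoef a)) z / PS (dcoef a) z)%C (s * ts)); auto using AC_INR_mul.
      - nra.
      - intros u Hu; apply convex_psi; auto; lra.
      - exact (Hlt _ A3). }
    (* Otherwise [|a(s x) - a(s y)|^2] would vanish at [s = 1], although it is nonnegative at
       [s = 1/2] and strictly increasing in between. *)
    assert (HQ1 : QS a x y <> 0%C).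
    { intros E.
      set (y0 := fun s => sqn (PS a (RtoC s * x) - PS a (RtoC s * y))%C).
      destruct (MVT_cor2 y0 (fun s => 2 * s * sqn (x - y)%C
        * radial a (RtoC s * x)%C (RtoC s * y)%C) (1 / 2) 1) as [c [Ec Hc]]; [lra | |].
      { intros c Hc; apply is_derive_Reals, is_derive_sqn_ray; auto; nra. }
      assert (y0 1 = 0).
      { unfold y0; rewrite !Cmult_1_l, <- QS_mul, E by (auto; lra).
        rewrite Cmult_0_r; unfold sqn; simpl; ring. }
      assert (0 <= y0 (1 / 2)) by (unfold y0; rewrite sqn_Cmod; apply Rle_0_sqr).
      pose proof (Hrad c ltac:(lra)).
      assert (0 < sqn (x - y)%C) by (apply sqn_pos; now apply Cminus_eq_contra).
      assert (0 < 2 * c * sqn (x - y)%C * radial a (RtoC c * x)%C (RtoC c * y)%C).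
      { repeat apply Rmult_lt_0_compat; lra. }
      nra. }
    assert (Hlim : kap beta ts * sqn (QS a x y) <= radial a x y).
    { set (u := fun s => radial a (RtoC s * x)%C (RtoC s * y)%C
                         - kap beta ts * sqn (QS a (RtoC s * x) (RtoC s * y))).
      assert (Cu : continuous u 1).
      { assert (CQ : forall c, AC c -> ccont (fun s : R => QS c (RtoC s * x) (RtoC s * y)) 1).
        { intros c Hc; apply ccont_QS; auto using ccont_ray; rewrite Cmult_1_l; lra. }
        apply continuous_minus_R.
        - apply ccont_fst, ccont_mult; [| apply ccont_conj]; apply CQ; auto using AC_INR_mul.
        - apply continuous_mult_R; [apply continuous_const|].
          destruct (proj1 (ccont_components _ _) (CQ a Ha)).
          apply continuous_plus_R; now apply continuous_mult_R. }
      assert (Hu : 0 <= u 1).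
      { apply Rnot_lt_le; intros Hn; rewrite continuous_eps in Cu.
        destruct (Cu (- u 1) ltac:(lra)) as [d Hd]; pose proof (cond_pos d).
        set (s := 1 - Rmin d 1 / 2).
        pose proof (Rmin_l d 1); pose proof (Rmin_r d 1).
        assert (0 < Rmin d 1) by (apply Rmin_pos; lra).
        assert (Hs' : 0 < s < 1) by (unfold s; lra).
        assert (B : ball 1 d s).
        { change (Rabs (s - 1) < d); unfold s; apply Rabs_def1; lra. }
        specialize (Hd s B); apply Rabs_def2 in Hd.
        specialize (Hs s Hs'); unfold u in *; lra. }
      unfold u in Hu; rewrite !Cmult_1_l in Hu; lra. }
    pose proof (sqn_pos _ HQ1); nra. }
  (* The set of good radii is open: by compactness positivity extends to radius [ts + d]. As [ts] is
     the supremum within [[0, r1]], this forces [ts >= r1]. *)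
  destruct (bidisk_uniform (fun p d => in_bidisk (ts + d) p ->
              0 < radial a (fst p) (snd p))) as [d [Hd HP]].
  { intros p; destruct (classic (in_bidisk ts p)) as [Hp | Hp].
    - destruct Hp as [P1 P2]; exists 1; split; [lra|].
      assert (CQ : forall c, AC c -> ccont (fun p : CC => QS c (fst p) (snd p)) p).
      { intros c Hc; apply ccont_QS; auto using ccont_CC_fst, ccont_CC_snd; lra. }
      assert (CR : continuous (fun p : CC => radial a (fst p) (snd p)) p).
      { apply ccont_fst, ccont_mult; [| apply ccont_conj]; apply CQ; auto using AC_INR_mul. }
      rewrite continuous_eps in CR.
      generalize (CR _ (Hgood _ _ P1 P2)); apply filter_imp; intros x Hx _.
      apply Rabs_def2 in Hx; lra.
    - destruct (not_in_bidisk_locally ts p Hp) as [t' [Ht' H]].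
      exists (t' - ts); split; [lra|]; revert H; apply filter_imp; intros x Hx Hx'.
      exfalso; apply Hx; now replace (ts + (t' - ts)) with t' in Hx' by ring. }
  { intros p d d' Hd H [P1 P2]; apply H; split; lra. }
  set (t2 := Rmin (ts + d) r1).
  assert (Ht2 : t2 <= ts + d) by apply Rmin_l; assert (Ht2' : t2 <= r1) by apply Rmin_r.
  assert (HT : T t2).
  { split; [split; auto; apply Rmin_glb; lra|].
    intros x y Hx Hy; apply (HP (x, y)); split; simpl; lra. }
  apply Hub in HT.
  apply Hnr1; intros x y Hx Hy; apply Hgood.
  - unfold t2, Rmin in HT; destruct (Rle_dec (ts + d) r1); lra.
  - unfold t2, Rmin in HT; destruct (Rle_dec (ts + d) r1); lra.
Qed.

Lemma convex_ratio_bound (beta : R) (a : nat -> C) (z w : C) (t : R) :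
  0 < beta <= 2 -> convex_map beta a -> Cmod z <= t -> Cmod w <= t -> t < 1 ->
  kap beta t * sqn (QS a z w) <= radial a z w.
Proof.
  intros Hb Hconv Hz Hw Ht; assert (Ha : AC a) by apply Hconv.
  pose proof (Cmod_ge_0 z).
  assert (HQ : QS a z w <> 0%C).
  { apply radial_QS_neq_0, radial_pos with beta; auto; lra. }
  unfold radial; rewrite <- fst_Cdiv by auto.
  apply Rmult_le_compat_r; [left; now apply sqn_pos|].
  apply (ratio_lower_bound a _
    (fun z => 1 + z * PS (dcoef (dcoef a)) z / PS (dcoef a) z)%C t); auto using AC_INR_mul.
  - lra.
  - intros u Hu; apply convex_psi; auto; lra.
  - intros x y Hx Hy; apply radial_pos with beta; auto; lra.
Qed.

Lemma convex_two_point (beta : R) (a : nat -> C) (z w : C) (r : R) :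
  0 < beta <= 2 -> convex_map beta a -> z <> w -> Cmod z <= r -> Cmod w <= r -> r < 1 ->
  Rpower (1 + r) (- beta) <= Cmod (QS a z w).
Proof.
  intros Hb Hconv Hne Hz Hw Hr; assert (Ha : AC a) by apply Hconv.
  pose proof (Cmod_ge_0 z) as Hz0.
  assert (Hzw : 0 < sqn (z - w)%C) by (apply sqn_pos; now apply Cminus_eq_contra).
  set (Q := fun s => QS a (RtoC s * z) (RtoC s * w)).
  assert (Hray : forall s x, 0 <= s <= 1 -> Cmod x <= r -> Cmod (RtoC s * x)%C <= r * s).
  { intros s x Hs Hx; rewrite Cmod_ray by lra; nra. }
  assert (HQ : forall s, 0 <= s <= 1 -> 0 < sqn (Q s)).
  { intros s Hs; apply sqn_pos, radial_QS_neq_0, radial_pos with beta; auto;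
      eapply Rle_lt_trans; try (apply Hray; eauto); nra. }
  set (D := fun s => sqn (PS a (RtoC s * z) - PS a (RtoC s * w))%C).
  assert (HDE : forall s, 0 <= s <= 1 -> D s = s * s * sqn (z - w)%C * sqn (Q s)).
  { intros s Hs; unfold D.
    rewrite <- QS_mul; auto; try (eapply Rle_lt_trans; [apply Hray; eauto | nra]).
    fold (Q s); unfold sqn; destruct (Q s), z, w; simpl; ring. }
  (* The last term cancels the loss: [(2 / s) (kap beta (r s) - 1) = - 2 beta r / (1 + r s)], so the
     first inequality makes [V] nondecreasing. *)
  set (V := fun s => ln (D s) - 2 * ln s + 2 * beta * ln (1 + r * s)).
  assert (HV : forall s, 0 < s <= 1 -> V s <= V 1).
  { intros s Hs; destruct (Rle_lt_or_eq_dec s 1 (proj2 Hs)) as [Hs1 | ->]; [| lra].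
    set (D' := fun s => 2 * s * sqn (z - w)%C * radial a (RtoC s * z)%C (RtoC s * w)%C).
    destruct (MVT_cor2 V (fun s => D' s / D s - 2 / s + 2 * beta * (r / (1 + r * s))) s 1)
      as [c [Ec Hc]]; auto.
    { intros c Hc; apply is_derive_Reals.
      assert (HDc : is_derive D c (D' c)) by (apply is_derive_sqn_ray; auto; nra).
      assert (HDp : 0 < D c).
      { rewrite HDE by lra; pose proof (HQ c ltac:(lra)).
        repeat apply Rmult_lt_0_compat; lra. }
      apply (is_derive_plus (V := R_NormedModule)); [apply (is_derive_minus (V := R_NormedModule))|].
      - replace (D' c / D c) with (D' c * / D c) by reflexivity.
        apply (is_derive_comp (V := R_NormedModule) ln D); auto.
        now apply is_derive_Reals, derivable_pt_lim_ln.
      - auto_derive; [lra | field; lra].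
      - auto_derive; [nra | field; nra]. }
    assert (0 <= D' c / D c - 2 / c + 2 * beta * (r / (1 + r * c))).
    { pose proof (convex_ratio_bound beta a (RtoC c * z)%C (RtoC c * w)%C (r * c) Hb Hconv
        (Hray c z ltac:(lra) Hz) (Hray c w ltac:(lra) Hw) ltac:(nra)) as B.
      fold (Q c) in B; specialize (HQ c ltac:(lra)).
      unfold D'; rewrite HDE by lra.
      replace (2 * c * sqn (z - w)%C * radial a (RtoC c * z)%C (RtoC c * w)%C
               / (c * c * sqn (z - w)%C * sqn (Q c)))
        with (2 / c * (radial a (RtoC c * z)%C (RtoC c * w)%C / sqn (Q c))) by (field; lra).
      assert (K : kap beta (r * c) <= radial a (RtoC c * z)%C (RtoC c * w)%C / sqn (Q c)).
      { apply Rmult_le_reg_r with (sqn (Q c)); auto.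
        unfold Rdiv; rewrite Rmult_assoc, Rinv_l; lra. }
      assert (Hc2 : 0 <= 2 / c) by (left; apply Rdiv_lt_0_compat; lra).
      apply (Rmult_le_compat_l (2 / c)) in K; auto.
      assert (E : 2 / c * kap beta (r * c) = 2 / c - 2 * beta * (r / (1 + r * c))).
      { unfold kap; field; nra. }
      lra. }
    assert (0 <= V 1 - V s); [| lra]. rewrite Ec; apply Rmult_le_pos; lra. }
  (* [V] has no value at [s = 0]. Up to a constant it is [U], which is continuous there with
     [U 0 = 0] because [h'(0) = 1]. *)
  set (U := fun s => ln (sqn (Q s)) + 2 * beta * ln (1 + r * s)).
  assert (HVU : forall s, 0 < s <= 1 -> V s = ln (sqn (z - w)%C) + U s).
  { intros s Hs; unfold V, U; specialize (HQ s ltac:(lra)); rewrite HDE by lra.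
    rewrite !ln_mult; try nra; repeat apply Rmult_lt_0_compat; lra. }
  assert (HQ0 : sqn (Q 0) = 1).
  { unfold Q; rewrite !Cmult_0_l, QS_diag, PS_0, (dcoef_at_0 beta) by (auto using AC_dcoef; rewrite Cmod_0; lra).
    unfold sqn; simpl; ring. }
  assert (HU0 : U 0 = 0).
  { unfold U; rewrite HQ0, Rmult_0_r, Rplus_0_r, ln_1; ring. }
  assert (CU : continuous U 0).
  { assert (CQ : ccont Q 0).
    { apply ccont_QS; auto using ccont_ray; rewrite Cmult_0_l, Cmod_0; lra. }
    destruct (proj1 (ccont_components _ _) CQ).
    apply continuous_plus_R.
    - apply (continuous_comp (fun s => sqn (Q s)) ln).
      + apply continuous_plus_R; now apply continuous_mult_R.
      + rewrite HQ0; apply (ex_derive_continuous (V := R_NormedModule) ln).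
        auto_derive; lra.
    - apply (ex_derive_continuous (V := R_NormedModule) (fun s => 2 * beta * ln (1 + r * s))).
      auto_derive; lra. }
  assert (HU1 : 0 <= U 1).
  { apply Rnot_lt_le; intros Hn; rewrite continuous_eps in CU.
    destruct (CU (- U 1) ltac:(lra)) as [d Hd]; pose proof (cond_pos d).
    set (s := Rmin d 1 / 2).
    pose proof (Rmin_l d 1); pose proof (Rmin_r d 1).
    assert (0 < Rmin d 1) by (apply Rmin_pos; lra).
    assert (Hs' : 0 < s <= 1) by (unfold s; lra).
    assert (B : ball 0 d s).
    { change (Rabs (s - 0) < d); rewrite Rabs_pos_eq; unfold s; lra. }
    specialize (Hd s B); rewrite HU0 in Hd; apply Rabs_def2 in Hd.
    specialize (HV s Hs'); rewrite !HVU in HV by lra; lra. }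
  unfold U in HU1; rewrite Rmult_1_r in HU1.
  assert (EQ : Q 1 = QS a z w) by (unfold Q; now rewrite !Cmult_1_l).
  rewrite EQ, sqn_Cmod in HU1.
  assert (HC : 0 < Cmod (QS a z w)).
  { rewrite <- EQ; specialize (HQ 1 ltac:(lra)); rewrite sqn_Cmod in HQ.
    pose proof (Cmod_ge_0 (Q 1)); nra. }
  rewrite ln_mult in HU1 by auto.
  unfold Rpower; rewrite <- (exp_ln (Cmod (QS a z w))) by auto.
  assert (L : - beta * ln (1 + r) <= ln (Cmod (QS a z w))) by lra.
  destruct (Rle_lt_or_eq_dec _ _ L) as [L' | ->]; [left; now apply exp_increasing | lra].
Qed.

Lemma shear_two_point (beta : R) (a b : nat -> C) (u : C) (z w : C) (r : R) :
  0 < beta <= 2 -> convex_map beta a -> AC b -> Cmod u = 1 ->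
  (forall z, Cmod z < 1 -> PS (dcoef b) z = (u * (z * PS (dcoef a) z))%C) ->
  z <> w -> Cmod z <= r -> Cmod w <= r -> r < 1 ->
  (1 - r) * Rpower (1 + r) (- beta) <= Cmod (QS a z w + QS b z w)%C.
Proof.
  intros Hb Hconv Ab Hu Hg Hne Hz Hw Hr; assert (Ha : AC a) by apply Hconv.
  pose proof (Cmod_ge_0 z).
  assert (HQ : QS a z w <> 0%C).
  { apply radial_QS_neq_0, radial_pos with beta; auto; lra. }
  assert (B : 1 - r <= fst (QS (fun k => a k + b k)%C z w / QS a z w)%C).
  { apply (ratio_lower_bound a _ (fun z => 1 + u * z)%C r); auto using AC_plus.
    - lra.
    - intros y Hy; split; [apply Hconv; lra | split].
      + transitivity (PS (fun k => dcoef a k + dcoef b k)%C y).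
        * apply PS_ext; intros k.
          change (RtoC (INR (S k)) * (a (S k) + b (S k))
            = RtoC (INR (S k)) * a (S k) + RtoC (INR (S k)) * b (S k))%C; ring.
        * rewrite PS_plus, Hg by (auto using AC_dcoef; lra); ring.
      + cbn [fst Cplus RtoC].
        pose proof (abs_fst_le_Cmod (u * y)%C) as A; rewrite Cmod_mult, Hu in A.
        pose proof (Rle_abs (- fst (u * y)%C)) as A'; rewrite Rabs_Ropp in A'.
        cbn [fst] in *; lra.
    - intros x y Hx Hy; apply radial_pos with beta; auto; lra. }
  rewrite QS_plus in B by (auto; lra).
  set (F := (QS a z w + QS b z w)%C) in *.
  pose proof (convex_two_point beta a z w r Hb Hconv Hne Hz Hw Hr) as T.
  replace F with (F / QS a z w * QS a z w)%C by (field; auto).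
  rewrite Cmod_mult; apply Rmult_le_compat; auto; [lra | left; apply exp_pos |].
  eapply Rle_trans; [exact B|]; eapply Rle_trans; [apply Rle_abs | apply abs_fst_le_Cmod].
Qed.

(** * Comparison of the distortion bound with [Acap] *)

Lemma le_of_derive_nonneg (f f' : R -> R) (x : R) :
  0 <= x -> (forall c, 0 <= c <= x -> is_derive f c (f' c)) ->
  (forall c, 0 <= c <= x -> 0 <= f' c) -> f 0 <= f x.
Proof.
  intros Hx Hd Hp; destruct (Rle_lt_or_eq_dec _ _ Hx) as [H | <-]; [| lra].
  destruct (MVT_cor2 f f' 0 x H) as [c [Ec Hc]].
  - intros c Hc; now apply is_derive_Reals, Hd.
  - specialize (Hp c ltac:(lra)); nra.
Qed.

Lemma ln_lower_bound (x : R) : 0 <= x -> 2 * x / (2 + x) <= ln (1 + x).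
Proof.
  intros Hx.
  pose proof (le_of_derive_nonneg (fun x => ln (1 + x) - 2 * x / (2 + x))
    (fun x => x * x / ((1 + x) * ((2 + x) * (2 + x)))) x Hx) as H.
  simpl in H; rewrite !Rplus_0_r, ln_1 in H.
  replace (0 - 2 * 0 / 2) with 0 in H by field.
  apply Rminus_le_0, H.
  - intros c Hc; auto_derive; [lra | field; lra].
  - intros c Hc; apply Rmult_le_pos; [nra|].
    left; apply Rinv_0_lt_compat; nra.
Qed.

Lemma bernoulli_Rpower (d x : R) : 0 <= d <= 1 -> 0 <= x -> Rpower (1 + x) d <= 1 + d * x.
Proof.
  intros Hd Hx.
  pose proof (le_of_derive_nonneg (fun x => ln (1 + d * x) - d * ln (1 + x))
    (fun x => d / (1 + d * x) - d / (1 + x)) x Hx) as H.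
  simpl in H; rewrite Rmult_0_r, !Rplus_0_r, ln_1, Rmult_0_r, Rminus_0_r in H.
  assert (H0 : 0 <= d * x) by nra.
  unfold Rpower; rewrite <- (exp_ln (1 + d * x)) by lra.
  assert (L : d * ln (1 + x) <= ln (1 + d * x)).
  { apply Rminus_le_0, H.
    - intros c Hc; assert (0 <= d * c) by nra; auto_derive; [repeat split; lra | field; lra].
    - intros c Hc; assert (0 <= d * c) by nra.
      apply (proj1 (Rminus_le_0 _ _)); apply Rmult_le_compat_l; [lra|].
      apply Rinv_le_contravar; nra. }
  destruct (Rle_lt_or_eq_dec _ _ L) as [L' | ->]; [left; now apply exp_increasing | lra].
Qed.

Lemma Lfun_at_0 (alpha : R) : Lfun 0 alpha = 0.
Proof.
  unfold Lfun; destruct (Req_EM_T alpha 0) as [|N0].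
  { rewrite Rplus_0_r, ln_1; field. }
  destruct (Req_EM_T alpha (1 / 2)) as [|N1]; [rewrite Rplus_0_r, ln_1; ring|].
  unfold Rpower; rewrite Rplus_0_r, ln_1, Rmult_0_r, exp_0; field; lra.
Qed.

Lemma Rpower_minus_2 (x y : R) : 0 < x -> Rpower x (y - 2) = Rpower x y / (x * x).
Proof.
  intros Hx; unfold Rminus; rewrite Rpower_plus, Rpower_Ropp.
  replace 2 with (1 + 1) by ring; rewrite Rpower_plus, Rpower_1 by auto; reflexivity.
Qed.

(** The integral representation of [L] in differential form, common to its three closed
    expressions. *)
Lemma is_derive_Lfun (alpha x : R) : 0 <= x ->
  is_derive (fun r => Lfun r alpha) x ((1 - x) * Rpower (1 + x) (- (2 * (1 - alpha)))).
Proof.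
  intros Hx; unfold Lfun.
  replace (- (2 * (1 - alpha))) with (2 * alpha - 2) by ring.
  rewrite Rpower_minus_2 by lra.
  destruct (Req_EM_T alpha 0) as [->|N0].
  { rewrite Rmult_0_r, Rpower_O by lra; auto_derive; [lra | field; lra]. }
  destruct (Req_EM_T alpha (1 / 2)) as [->|N1].
  { replace (2 * (1 / 2)) with 1 by field; rewrite Rpower_1 by lra.
    auto_derive; [lra | field; lra]. }
  unfold Rpower; auto_derive.
  - repeat split; try lra.
    repeat apply Rmult_integral_contrapositive_currified; lra.
  - field; lra.
Qed.

(** The left side is the derivative of [L], the right side that of [x (1 + x)^(-(3 - 2 alpha) / 2)].
    With [d = alpha - 1/2] the claim becomes [1 - x^2 <= (1 + x)^(-d) (1 + d x)]. *)
Lemma distortion_comparison (alpha x : R) : 0 <= alpha < 1 -> 0 <= x < 1 ->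
  (1 - x) * Rpower (1 + x) (- (2 * (1 - alpha)))
  <= Rpower (1 + x) (- ((3 - 2 * alpha) / 2)) * (1 - (3 - 2 * alpha) / 2 * x / (1 + x)).
Proof.
  intros Ha Hx.
  set (d := alpha - 1 / 2).
  replace (- ((3 - 2 * alpha) / 2)) with (- (2 * (1 - alpha)) + - d) by (unfold d; field).
  rewrite Rpower_plus.
  replace (1 - (3 - 2 * alpha) / 2 * x / (1 + x)) with ((1 + d * x) / (1 + x))
    by (unfold d; field; lra).
  rewrite (Rmult_comm (1 - x)), Rmult_assoc; apply Rmult_le_compat_l; [left; apply exp_pos|].
  apply Rmult_le_reg_r with (1 + x); [lra|].
  replace (Rpower (1 + x) (- d) * ((1 + d * x) / (1 + x)) * (1 + x))
    with (Rpower (1 + x) (- d) * (1 + d * x)) by (field; lra).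
  (* For [d >= 0] Bernoulli's inequality makes the right side at least 1. For [d < 0] it is applied
     to the exponent [1 + d], after one factor [1 + x] has been split off. *)
  destruct (Rle_lt_dec 0 d) as [Hd | Hd].
  - pose proof (bernoulli_Rpower d x ltac:(unfold d in *; lra) ltac:(lra)) as B.
    assert (P : 0 < Rpower (1 + x) d) by apply exp_pos.
    rewrite Rpower_Ropp.
    apply Rle_trans with 1; [nra|].
    apply Rmult_le_reg_l with (Rpower (1 + x) d); auto.
    rewrite <- Rmult_assoc, Rinv_r; lra.
  - pose proof (bernoulli_Rpower (1 + d) x ltac:(unfold d in *; lra) ltac:(lra)) as B.
    assert (P : 0 < Rpower (1 + x) (1 + d)) by apply exp_pos.
    replace (- d) with (1 + - (1 + d)) by ring.
    rewrite Rpower_plus, Rpower_1, Rpower_Ropp by lra.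
    rewrite (Rmult_comm (1 - x)), Rmult_assoc; apply Rmult_le_compat_l; [lra|].
    apply Rmult_le_reg_l with (Rpower (1 + x) (1 + d)); auto.
    rewrite <- Rmult_assoc, Rinv_r, Rmult_1_l by lra.
    apply Rle_trans with ((1 + (1 + d) * x) * (1 - x)); [apply Rmult_le_compat_r; lra|].
    assert (- 1 / 2 <= d) by (unfold d; lra).
    assert (0 <= (1 + d) * (x * x)) by (apply Rmult_le_pos; nra).
    nra.
Qed.

Definition distortion (beta r : R) : R := (1 - r) * Rpower (1 + r) (- beta).

(** Inserting the upper bound into [Acap] reproduces [distortion] exactly, which dictates the
    exponent. *)
Lemma Lfun_bounds (alpha r : R) : 0 <= alpha < 1 -> 0 <= r < 1 ->
  0 <= Lfun r alpha <= r * Rpower (1 + r) (- ((3 - 2 * alpha) / 2)).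
Proof.
  intros Ha Hr; split.
  - rewrite <- (Lfun_at_0 alpha).
    apply (le_of_derive_nonneg (fun r => Lfun r alpha)
      (fun x => (1 - x) * Rpower (1 + x) (- (2 * (1 - alpha))))); [lra | |].
    + intros c Hc; apply is_derive_Lfun; lra.
    + intros c Hc; apply Rmult_le_pos; [lra | left; apply exp_pos].
  - set (g := (3 - 2 * alpha) / 2).
    apply Rminus_le_0.
    pose proof (le_of_derive_nonneg (fun r => r * Rpower (1 + r) (- g) - Lfun r alpha)
      (fun x => Rpower (1 + x) (- g) * (1 - g * x / (1 + x))
                - (1 - x) * Rpower (1 + x) (- (2 * (1 - alpha)))) r ltac:(lra)) as H.
    simpl in H; rewrite Lfun_at_0, Rmult_0_l, Rminus_0_r in H; apply H.
    + intros c Hc; apply (is_derive_minus (V := R_NormedModule)).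
      * unfold Rpower; auto_derive; [lra | field; lra].
      * apply is_derive_Lfun; lra.
    + intros c Hc; apply (proj1 (Rminus_le_0 _ _)), distortion_comparison; lra.
Qed.

Lemma Acap_le_distortion (alpha r : R) : 0 <= alpha < 1 -> 0 < r < 1 ->
  Acap r alpha <= distortion (2 * (1 - alpha)) r.
Proof.
  intros Ha Hr; unfold Acap, distortion.
  destruct (Lfun_bounds alpha r Ha ltac:(lra)) as [L0 L1].
  set (g := (3 - 2 * alpha) / 2) in *; set (P := Rpower (1 + r) (- g)) in *.
  assert (E : Rpower (1 + r) (- (2 * (1 - alpha))) = (1 + r) * (P * P)).
  { replace (- (2 * (1 - alpha))) with (1 + (- g + - g)) by (unfold g; field).
    rewrite !Rpower_plus, Rpower_1 by lra; reflexivity. }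
  rewrite E; apply Rle_trans with ((1 - r ^ 2) / r ^ 2 * (r * P) ^ 2).
  - apply Rmult_le_compat_l; [| now apply pow_incr].
    apply Rmult_le_pos; [nra | left; apply Rinv_0_lt_compat, pow_lt; lra].
  - right; field; lra.
Qed.

Lemma distortion_decr (beta r s : R) : 0 < beta -> 0 <= r -> r < s -> s < 1 ->
  distortion beta s < distortion beta r.
Proof.
  intros Hb Hr Hrs Hs; unfold distortion; rewrite !Rpower_Ropp.
  assert (Hle : Rpower (1 + r) beta <= Rpower (1 + s) beta) by (apply Rle_Rpower_l; lra).
  assert (P : 0 < Rpower (1 + r) beta) by apply exp_pos.
  apply Rle_lt_trans with ((1 - s) * / Rpower (1 + r) beta).
  - apply Rmult_le_compat_l; [lra|]; now apply Rinv_le_contravar.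
  - apply Rmult_lt_compat_r; [now apply Rinv_0_lt_compat | lra].
Qed.

(** * The class F(alpha) and its coefficients *)

(** With [beta = 2 - 2 alpha] the product of the [j - 2 alpha] is the rising factorial of [beta], so
    [k A_k] bounds the coefficient of [z^(k-1)] in [h']. *)
Lemma INR_Ak (alpha : R) (j : nat) :
  INR (S j) * Ak alpha (S j) = maj (2 * (1 - alpha)) j.
Proof.
  induction j as [|j IH]; [unfold Ak; simpl; field|].
  change (maj (2 * (1 - alpha)) (S j))
    with (maj (2 * (1 - alpha)) j * (2 * (1 - alpha) + INR j) / INR (S j)).
  rewrite <- IH; unfold Ak.
  change (Aprod alpha (S (S j))) with (Aprod alpha (S j) * (INR (S (S j)) - 2 * alpha)).
  change (Factorial.fact (S (S j))) with ((S (S j)) * Factorial.fact (S j))%nat.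
  rewrite mult_INR, (S_INR (S j)), S_INR.
  pose proof (pos_INR j); field; split; [apply INR_fact_neq_0 | split; lra].
Qed.

(** The weight in the second tail is [(k - 1) A_(k-1)]: the relation [g' = u z h'] gives
    [k b_k = u (k - 1) a_(k-1)]. *)
Lemma INR_Ak_antianalytic (alpha : R) (j : nat) : alpha < 1 ->
  INR (S (S j)) * (INR (S (S j)) - 1) / (INR (S (S j)) - 2 * alpha) * Ak alpha (S (S j))
  = maj (2 * (1 - alpha)) j.
Proof.
  intros Ha; pose proof (INR_Ak alpha (S j)) as E.
  change (maj (2 * (1 - alpha)) (S j))
    with (maj (2 * (1 - alpha)) j * (2 * (1 - alpha) + INR j) / INR (S j)) in E.
  assert (E' : Ak alpha (S (S j))
    = maj (2 * (1 - alpha)) j * (2 * (1 - alpha) + INR j) / INR (S j) / INR (S (S j))).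
  { rewrite <- E; field; apply not_0_INR; lia. }
  rewrite E', !S_INR; pose proof (pos_INR j); field; lra.
Qed.

(** * Uniqueness of coefficients and translation of the class *)

Lemma PS_mul_id_zero_at_0 (c : nat -> C) :
  AC c -> (forall z, Cmod z < 1 -> (z * PS c z = 0)%C) -> c 0%nat = 0%C.
Proof.
  intros Hc H.
  apply Cmod_eq_0; apply Rle_antisym; [| apply Cmod_ge_0].
  apply Rnot_lt_le; intros Hp; rewrite <- PS_0 in Hp by auto.
  assert (Z0 : Cmod 0%C < 1) by (rewrite Cmod_0; lra).
  pose proof (cderiv_ccont _ _ _ (cderiv_PS c 0%C Hc Z0) _ Hp) as [d Hd].
  pose proof (cond_pos d) as Hdp.
  set (s := Rmin d 1 / 2).
  pose proof (Rmin_l d 1); pose proof (Rmin_r d 1).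
  assert (0 < Rmin d 1) by (apply Rmin_pos; lra).
  assert (Hs : 0 < s < 1 /\ s < d) by (unfold s; lra).
  assert (Cs : Cmod (RtoC s) = s) by (rewrite Cmod_R, Rabs_pos_eq; lra).
  assert (Ps : PS c (RtoC s) = 0%C).
  { specialize (H (RtoC s) ltac:(lra)).
    assert (Hs0 : RtoC s <> 0%C) by (intros E; apply RtoC_inj in E; lra).
    replace (PS c (RtoC s)) with (RtoC s * PS c (RtoC s) / RtoC s)%C by (field; auto).
    rewrite H; field; auto. }
  assert (B : @ball C_UniformSpace (RtoC 0) d (RtoC s)).
  { apply C_NormedModule_mixin_compat1; change (Cmod (RtoC s - 0)%C < d).
    replace (RtoC s - 0)%C with (RtoC s) by ring; lra. }
  specialize (Hd _ B); rewrite Ps in Hd.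
  replace (0 - PS c 0)%C with (- PS c 0)%C in Hd by ring; rewrite Cmod_opp in Hd; lra.
Qed.

(** The factor [z] restricts the hypothesis to [z <> 0], the form that survives cancelling a power
    of [z], so the induction may drop constant terms one by one. *)
Lemma PS_mul_id_zero (c : nat -> C) :
  AC c -> (forall z, Cmod z < 1 -> (z * PS c z = 0)%C) -> forall k, c k = 0%C.
Proof.
  intros Hc H k; revert c Hc H; induction k as [|k IH]; intros c Hc H.
  - now apply PS_mul_id_zero_at_0.
  - assert (Hc0 : forall z, Cmod z < 1 -> PS c z = (c 0%nat + z * PS (fun k => c (S k)) z)%C).
    { intros z Hz; now apply PS_unshift. }
    apply (IH (fun k => c (S k))); [now apply AC_shift|]; intros z Hz.
    destruct (Ceq_dec z 0%C) as [-> | Hz0]; [ring|].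
    assert (E0 : c 0%nat = 0%C) by now apply PS_mul_id_zero_at_0.
    specialize (H z Hz); rewrite Hc0, E0 in H by auto.
    replace (z * PS (fun k => c (S k)) z)%C
      with (z * (0 + z * PS (fun k => c (S k)) z) / z)%C by (field; auto).
    rewrite H; field; auto.
Qed.

Lemma antianalytic_coef (a b : nat -> C) (u : C) :
  AC a -> AC b -> (forall z, Cmod z < 1 -> PS (dcoef b) z = (u * (z * PS (dcoef a) z))%C) ->
  forall k, (dcoef b (S k) : C) = (u * dcoef a k)%C.
Proof.
  intros Ha Hb H.
  assert (Hb' := AC_dcoef _ Hb); assert (Ha' := AC_dcoef _ Ha).
  assert (Hz : forall k, (dcoef b (S k) + (- u) * dcoef a k)%C = 0%C).
  { apply PS_mul_id_zero; [apply AC_plus; [now apply AC_shift in Hb' | now apply AC_scal]|].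
    intros z Hz.
    rewrite (PS_plus (fun k => dcoef b (S k)) (fun k => - u * dcoef a k)%C), PS_scal;
      auto using AC_shift, AC_scal.
    assert (E0 : (dcoef b 0%nat : C) = 0%C).
    { rewrite <- (PS_0 (dcoef b)) by auto; rewrite H by (rewrite Cmod_0; lra); ring. }
    pose proof (PS_unshift (dcoef b) z Hb' Hz) as E; rewrite H, E0 in E by auto.
    rewrite Cmult_plus_distr_l.
    replace (z * PS (fun k => dcoef b (S k)) z)%C
      with (0 + z * PS (fun k => dcoef b (S k)) z)%C by ring.
    rewrite <- E; ring. }
  intros k; specialize (Hz k).
  replace (dcoef b (S k) : C) with (dcoef b (S k) + - u * dcoef a k + u * dcoef a k)%C by ring.
  rewrite Hz; ring.
Qed.

Lemma in_F_convex (alpha : R) (a b : nat -> Cx) : in_F alpha a b ->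
  convex_map (2 * (1 - alpha)) a /\ AC b /\ b 0%nat = C0 /\ a 0%nat = C0 /\
  exists u : C, Cmod u = 1 /\
    forall z, Cmod z < 1 -> PS (dcoef b) z = (u * (z * PS (dcoef a) z))%C.
Proof.
  intros [_ [Ha0 [Ha1 [Hb0 [Ca [Cb [Hp [th Hth]]]]]]]].
  pose proof (ps_sum_AC a Ca) as Ha; pose proof (ps_sum_AC b Cb) as Hb.
  split; [| split; [exact Hb | split; [exact Hb0 | split; [exact Ha0|]]]].
  - split; [exact Ha | split; [exact Ha1|]]; intros z Hz.
    destruct (Hp z (PS (dcoef a) z) (PS (dcoef (dcoef a)) z)) as [N P].
    + now rewrite Defs_Cabs_eq.
    + apply ps_sum_PS; auto using AC_dcoef.
    + apply ps_sum_PS; auto using AC_dcoef.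
    + split; [exact N|].
      assert (E : Defs.Cdiv (Cmul z (PS (dcoef (dcoef a)) z)) (PS (dcoef a) z)
        = (z * PS (dcoef (dcoef a)) z / PS (dcoef a) z)%C).
      { unfold Defs.Cdiv, Cdiv, Defs.Cinv, Cinv, Cnorm2, Cmul, Cmult; simpl.
        rewrite !Rmult_1_r; reflexivity. }
      rewrite E in P; unfold Cre, Cadd, Defs.C1 in P; cbn [fst] in P; lra.
  - exists (Cexpi th); split; [apply Cmod_Cexpi|]; intros z Hz.
    apply Hth; [now rewrite Defs_Cabs_eq | |]; apply ps_sum_PS; auto using AC_dcoef.
Qed.

(** * Sections *)

Lemma Csum1_Csum (f : nat -> C) (n : nat) : f 0%nat = 0%C -> Csum1 f n = Csum f (S n).
Proof.
  intros H0; induction n as [|n IH].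
  - simpl; rewrite H0; change (RtoC 0 = RtoC 0 + RtoC 0)%C; ring.
  - change (Csum1 f (S n)) with (Csum1 f n + f (S n))%C; now rewrite IH.
Qed.

Lemma section_diff (c : nat -> C) (n : nat) (z w : C) : c 0%nat = C0 ->
  ((z - w) * Csum (fun k => c k * GQ k z w) (S n)
   = Csum1 (fun k => Cmul (c k) (Defs.Cpow z k)) n
     - Csum1 (fun k => Cmul (c k) (Defs.Cpow w k)) n)%C.
Proof.
  intros H0; rewrite !Csum1_Csum; try (rewrite H0; change ((0 * 1)%C = 0%C); ring).
  rewrite <- Csum_scal.
  rewrite (Csum_ext _ (fun k => Cmul (c k) (Defs.Cpow z k) + (-1) * Cmul (c k) (Defs.Cpow w k))%C).
  - rewrite Csum_plus, Csum_scal; ring.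
  - intros k _; rewrite !Defs_Cpow_eq.
    change (((z - w) * (c k * GQ k z w))%C = (c k * z ^ k + (-1) * (c k * w ^ k))%C).
    replace ((z - w) * (c k * GQ k z w))%C with (c k * ((z - w) * GQ k z w))%C by ring.
    rewrite GQ_mul; ring.
Qed.

(** The points lie in radius [r], but the tail is summed at the larger radius [s], which will be the
    zero of psi, where the convergence is given. Index [i + n] of [dcoef] belongs to the coefficient
    [k = i + n + 1]. *)
Lemma tail_bound (c : nat -> C) (v : nat -> R) (n : nat) (z w : C) (r s l : R) :
  Cmod z <= r -> Cmod w <= r -> 0 <= r <= s ->
  (forall i, Cmod (dcoef c (i + n)%nat) * s ^ (i + n) <= v i) ->
  infinite_sum v l ->
  Cmod (CSer (fun i => c (S n + i)%nat * GQ (S n + i) z w)%C) <= l.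
Proof.
  intros Hz Hw Hr Hv Hl; apply is_series_Reals in Hl.
  rewrite <- (is_series_unique _ _ Hl); apply CSer_le; [| now exists l].
  intros i; apply Rle_trans with (2 := Hv i).
  replace (S n + i)%nat with (S (i + n)) by lia.
  change (dcoef c (i + n)%nat) with (RtoC (INR (S (i + n))) * c (S (i + n)))%C.
  rewrite !Cmod_mult, Cmod_R, (Rabs_pos_eq (INR _)) by apply pos_INR.
  pose proof (GQ_bound (S (i + n)) z w r Hz Hw) as B.
  replace (S (i + n) - 1)%nat with (i + n)%nat in B by lia.
  assert (P : r ^ (i + n) <= s ^ (i + n)) by now apply pow_incr.
  replace (INR (S (i + n)) * Cmod (c (S (i + n))) * s ^ (i + n))
    with (Cmod (c (S (i + n))) * (INR (S (i + n)) * s ^ (i + n))) by ring.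
  apply Rmult_le_compat_l; [apply Cmod_ge_0|].
  eapply Rle_trans; [exact B|]; apply Rmult_le_compat_l; [apply pos_INR | exact P].
Qed.

Lemma rotate_to_conj (e x : C) : Cmod e = 1 ->
  exists u : C, Cmod u = 1 /\ (u * x = e * Cconj x)%C.
Proof.
  intros He; destruct (Ceq_dec x 0%C) as [-> | Hx].
  - exists 1%C; split; [apply Cmod_1|].
    unfold Cconj, Cmult, RtoC; simpl; f_equal; ring.
  - exists (e * Cconj x / x)%C; split; [| field; auto].
    rewrite Cmod_div, Cmod_mult, He, Cmod_conj by auto.
    field; apply Rgt_not_eq; now apply Cmod_gt_0.
Qed.

(* With [u] chosen so that [u x = e conj x] for [x = g z - g w], the harmonic function
   [h + e conj g] and the analytic function [h + u g] have differences of equal modulus. *)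
Lemma sections_univalent (alpha : R) (a b : nat -> Cx) (n m : nat) (rnm theta : R) :
  0 <= alpha < 1 -> in_F alpha a b -> (2 <= n)%nat -> (2 <= m)%nat ->
  0 < rnm < 1 -> psi_is n m rnm alpha 0 ->
  univalent_in_disk (s_poly a b n m theta) rnm.
Proof.
  intros Ha HF Hn Hm Hr0 [s1 [s2 [Hs1 [Hs2 Hpsi]]]] z w Hz Hw Heq.
  rewrite Defs_Cabs_eq in Hz, Hw.
  destruct (in_F_convex alpha a b HF) as [Hconv [Ab [Hb0 [Ha0 [u [Hu Hg]]]]]].
  assert (Aa : AC a) by apply Hconv.
  set (beta := 2 * (1 - alpha)) in *.
  assert (Hbeta : 0 < beta <= 2) by (unfold beta; lra).
  destruct (Ceq_dec z w) as [| Hne]; [assumption | exfalso].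
  set (r := Rmax (Cmod z) (Cmod w)).
  assert (Hzr : Cmod z <= r) by apply Rmax_l; assert (Hwr : Cmod w <= r) by apply Rmax_r.
  assert (Hrr : r < rnm) by now apply Rmax_lub_lt.
  pose proof (Cmod_ge_0 z) as Hz0.
  set (A := Csum (fun k => a k * GQ k z w)%C (S n)).
  set (B := Csum (fun k => b k * GQ k z w)%C (S m)).
  set (Ta := CSer (fun i => a (S n + i)%nat * GQ (S n + i) z w)%C).
  set (Tb := CSer (fun i => b (S m + i)%nat * GQ (S m + i) z w)%C).
  assert (QA : QS a z w = (A + Ta)%C).
  { apply (CSer_split (fun k => a k * GQ k z w)%C (S n)), AC_summable_GQ; auto; lra. }
  assert (QB : QS b z w = (B + Tb)%C).
  { apply (CSer_split (fun k => b k * GQ k z w)%C (S m)), AC_summable_GQ; auto; lra. }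
  assert (BA : Cmod Ta <= s1).
  { apply (tail_bound a _ n z w r rnm s1) with (5 := Hs1); auto; [lra|]; intros i; simpl.
    replace (i + n + 1)%nat with (S (i + n)) by lia.
    replace (S (i + n) - 1)%nat with (i + n)%nat by lia.
    rewrite INR_Ak; apply Rmult_le_compat_r; [apply pow_le; lra|].
    apply convex_coef_bound; auto; unfold beta in *; lra. }
  assert (BB : Cmod Tb <= s2).
  { apply (tail_bound b _ m z w r rnm s2) with (5 := Hs2); auto; [lra|]; intros i; simpl.
    (* The index is positive since [m >= 2]; its predecessor is the index of the matching
       coefficient of [h']. *)
    replace (i + m)%nat with (S (i + m - 1)) by lia.
    set (j := (i + m - 1)%nat).
    replace (S j + 1)%nat with (S (S j)) by lia.
    replace (S (S j) - 1)%nat with (S j) by lia.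
    rewrite INR_Ak_antianalytic by lra.
    rewrite (antianalytic_coef a b u Aa Ab Hg), Cmod_mult, Hu, Rmult_1_l.
    apply Rmult_le_compat_r; [apply pow_le; lra|].
    apply convex_coef_bound; auto; unfold beta in *; lra. }
  set (e := Cexpi theta : C).
  assert (He : Cmod e = 1) by apply Cmod_Cexpi.
  (* This restates that the harmonic polynomial takes equal values at [z] and [w]. *)
  assert (Hdiff : ((z - w) * A + e * Cconj ((z - w) * B) = 0)%C).
  { unfold A, B; rewrite !section_diff by auto.
    set (x := Csum1 (fun k => Cmul (a k) (Defs.Cpow z k)) n) in *.
    set (y := Csum1 (fun k => Cmul (b k) (Defs.Cpow z k)) m) in *.
    set (x' := Csum1 (fun k => Cmul (a k) (Defs.Cpow w k)) n) in *.
    set (y' := Csum1 (fun k => Cmul (b k) (Defs.Cpow w k)) m) in *.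
    assert (E : (x + e * Cconj y = x' + e * Cconj y')%C) by exact Heq.
    replace (x - x' + e * Cconj (y - y'))%C
      with ((x + e * Cconj y) - (x' + e * Cconj y'))%C.
    - rewrite E; ring.
    - destruct x, y, x', y', e; unfold Cminus, Cplus, Copp, Cmult, Cconj; simpl; f_equal; ring. }
  destruct (rotate_to_conj e ((z - w) * QS b z w)%C He) as [v [Hv Ev]].
  assert (Hzw : 0 < Cmod (z - w)%C).
  { apply Cmod_gt_0; now apply Cminus_eq_contra. }
  (* The series [v b] satisfies the same relation to [a] as [b], with the unimodular constant
     [v u]. *)
  assert (LB : distortion beta r <= Cmod (QS a z w + v * QS b z w)%C).
  { rewrite <- QS_scal by (auto; lra).
    apply (shear_two_point beta a (fun k => v * b k)%C (v * u)%C); auto using AC_scal; try lra.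
    - rewrite Cmod_mult, Hu, Hv; ring.
    - intros y Hy; transitivity (PS (fun k => v * dcoef b k)%C y).
      + apply PS_ext; intros k.
        change (RtoC (INR (S k)) * (v * b (S k)) = v * (RtoC (INR (S k)) * b (S k)))%C; ring.
      + rewrite PS_scal, Hg by auto using AC_dcoef; ring. }
  (* By the choice of [v] this modulus, times [|z - w|], is that of the harmonic difference; its
     polynomial part cancels by [Hdiff] and only the tails remain. *)
  assert (UB : Cmod (QS a z w + v * QS b z w)%C <= s1 + s2).
  { apply Rmult_le_reg_l with (Cmod (z - w)%C); auto.
    rewrite <- Cmod_mult.
    replace ((z - w) * (QS a z w + v * QS b z w))%C
      with ((z - w) * QS a z w + v * ((z - w) * QS b z w))%C by ring.
    rewrite Ev, QA, QB.
    replace ((z - w) * (A + Ta) + e * Cconj ((z - w) * (B + Tb)))%C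
      with (((z - w) * A + e * Cconj ((z - w) * B)) + ((z - w) * Ta + e * Cconj ((z - w) * Tb)))%C.
    - rewrite Hdiff, Cplus_0_l; eapply Rle_trans; [apply Cmod_triangle|].
      rewrite !Cmod_mult, He, Cmod_conj, !Cmod_mult; nra.
    - destruct A, B, Ta, Tb, z, w, e; unfold Cminus, Cplus, Copp, Cmult, Cconj; simpl; f_equal; ring. }
  (* Contradiction: [distortion r <= s1 + s2 = Acap rnm <= distortion rnm < distortion r]. *)
  pose proof (Acap_le_distortion alpha rnm Ha Hr0) as HA; fold beta in HA.
  pose proof (distortion_decr beta r rnm ltac:(lra) ltac:(lra) Hrr ltac:(lra)).
  lra.
Qed.

(** * The case alpha = 1/2 *)

Lemma maj_1 (k : nat) : maj 1 k = 1.
Proof.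
  induction k as [|k IH]; [reflexivity|].
  change (maj 1 (S k)) with (maj 1 k * (1 + INR k) / INR (S k)).
  rewrite IH, S_INR; pose proof (pos_INR k); field; lra.
Qed.

Lemma geom_tail (r l : R) (n : nat) (v : nat -> R) : 0 < r < 1 ->
  (forall i, v i = r ^ (i + n)) -> infinite_sum v l -> l = r ^ n / (1 - r).
Proof.
  intros Hr Hv Hl; apply is_series_Reals in Hl; rewrite <- (is_series_unique _ _ Hl).
  rewrite (Series_ext _ (fun i => r ^ n * r ^ i)).
  - rewrite Series_scal_l, Series_geom by (rewrite Rabs_pos_eq; lra); reflexivity.
  - intros i; rewrite Hv, pow_add; ring.
Qed.

(** Here [beta = 1], all majorants equal 1, and both tails are geometric series. *)
Lemma psi_half (n m : nat) (r : R) : (2 <= n)%nat -> (2 <= m)%nat -> 0 < r < 1 ->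
  psi_is n m r (1 / 2) 0 -> Acap r (1 / 2) = (r ^ n + r ^ m) / (1 - r).
Proof.
  intros Hn Hm Hr [s1 [s2 [H1 [H2 E]]]].
  apply (geom_tail r _ n) in H1; [apply (geom_tail r _ m) in H2| |]; auto.
  - replace (Acap r (1 / 2)) with (s1 + s2) by lra; rewrite H1, H2; field; lra.
  - intros i; simpl; replace (i + m)%nat with (S (i + m - 1)) by lia.
    set (j := (i + m - 1)%nat).
    replace (S j + 1)%nat with (S (S j)) by lia; replace (S (S j) - 1)%nat with (S j) by lia.
    rewrite INR_Ak_antianalytic by lra; replace (2 * (1 - 1 / 2)) with 1 by field.
    rewrite maj_1; ring.
  - intros i; simpl; replace (i + n + 1)%nat with (S (i + n)) by lia.
    replace (S (i + n) - 1)%nat with (i + n)%nat by lia.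
    rewrite INR_Ak; replace (2 * (1 - 1 / 2)) with 1 by field; rewrite maj_1; ring.
Qed.

Lemma Acap_half_lower (r : R) : 0 < r < 1 ->
  (1 - r) * ((1 + r) * ((2 - r) / (2 + r)) ^ 2) <= Acap r (1 / 2).
Proof.
  intros Hr; unfold Acap, Lfun.
  destruct (Req_EM_T (1 / 2) 0); [lra|]; destruct (Req_EM_T (1 / 2) (1 / 2)); [|lra].
  pose proof (ln_lower_bound r ltac:(lra)) as L.
  assert (P : 0 <= (2 - r) / (2 + r)) by (left; apply Rdiv_lt_0_compat; lra).
  assert (HL : r * ((2 - r) / (2 + r)) <= 2 * ln (1 + r) - r).
  { replace (r * ((2 - r) / (2 + r))) with (2 * (2 * r / (2 + r)) - r) by (field; lra); lra. }
  apply Rle_trans with ((1 - r ^ 2) / r ^ 2 * (r * ((2 - r) / (2 + r))) ^ 2).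
  - right; field; lra.
  - apply Rmult_le_compat_l.
    + apply Rmult_le_pos; [nra | left; apply Rinv_0_lt_compat, pow_lt; lra].
    + apply pow_incr; split; auto; apply Rmult_le_pos; lra.
Qed.

Lemma pow_le_exp (r : R) (l : nat) : 0 <= r -> r ^ l <= exp (- (INR l * (1 - r))).
Proof.
  intros Hr; replace (- (INR l * (1 - r))) with (INR l * (r - 1)) by ring.
  induction l as [|l IH]; [simpl; rewrite Rmult_0_l, exp_0; lra|].
  rewrite S_INR, Rmult_plus_distr_r, Rmult_1_l, exp_plus, (Rmult_comm (exp _)); simpl pow.
  assert (r <= exp (r - 1)) by (pose proof (exp_ineq1_le (r - 1)); lra).
  apply Rmult_le_compat; auto using pow_le.
Qed.

(** The number is factored as [4/3 * 3/2], with factors close to 1, where [ln_lower_bound] is sharp;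
    the next lemma proceeds likewise. *)
Lemma ln_2_lower : 2 / 3 <= ln 2.
Proof.
  pose proof (ln_lower_bound (1 / 3) ltac:(lra)); pose proof (ln_lower_bound (1 / 2) ltac:(lra)).
  replace 2 with ((1 + 1 / 3) * (1 + 1 / 2)) at 2 by field; rewrite ln_mult; lra.
Qed.

Lemma ln_5_lower : 3 / 2 <= ln 5.
Proof.
  pose proof (ln_lower_bound (1 / 3) ltac:(lra)); pose proof (ln_lower_bound (1 / 2) ltac:(lra)).
  pose proof (ln_lower_bound (1 / 4) ltac:(lra)).
  replace 5 with ((1 + 1 / 4) * (((1 + 1 / 3) * (1 + 1 / 2)) * ((1 + 1 / 3) * (1 + 1 / 2)))) by field.
  rewrite !ln_mult; lra.
Qed.

Lemma ln_3_lower : 1 <= ln 3.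
Proof.
  rewrite <- (ln_exp 1); apply ln_le; [apply exp_pos | apply exp_le_3].
Qed.

(** With [u = 1 - r] the zero of psi yields [u^2 g <= 2 exp (- l u)]. If [l u > 2 ln l], then
    [exp (l u) >= l^2], hence [(ln l)^2 g <= 1/2], which is too small for [g]. *)
Lemma radius_half (n m : nat) (r : R) : (2 <= n)%nat -> (2 <= m)%nat -> 0 < r < 1 ->
  psi_is n m r (1 / 2) 0 -> (3 <= Nat.min n m)%nat ->
  1 - 2 * ln (INR (Nat.min n m)) / INR (Nat.min n m) <= r.
Proof.
  intros Hn Hm Hr Hpsi Hl; set (l := Nat.min n m) in *.
  apply Rnot_lt_le; intros Hlt.
  assert (HlR : 3 <= INR l) by (apply le_INR in Hl; simpl in Hl; lra).
  set (lam := ln (INR l)) in *; set (u := 1 - r).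
  assert (Hlam : 1 <= lam).
  { apply Rle_trans with (1 := ln_3_lower); apply ln_le; lra. }
  assert (Hu : 2 * lam < INR l * u).
  { assert (E : 2 * lam / INR l < u) by (unfold u; lra).
    apply (Rmult_lt_compat_l (INR l)) in E; [| lra].
    replace (INR l * (2 * lam / INR l)) with (2 * lam) in E by (field; lra); lra. }
  set (g := (1 + r) * ((2 - r) / (2 + r)) ^ 2).
  assert (Hexp : u * u * g <= 2 * exp (- (INR l * u))).
  { pose proof (Acap_half_lower r Hr) as A; rewrite (psi_half n m r Hn Hm Hr Hpsi) in A.
    fold g u in A.
    assert (Pn : forall k, (l <= k)%nat -> r ^ k <= exp (- (INR l * u))).
    { intros k Hk; apply Rle_trans with (r ^ l); [| apply pow_le_exp; lra].
      replace k with (l + (k - l))%nat by lia; rewrite pow_add.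
      rewrite <- (Rmult_1_r (r ^ l)) at 2; apply Rmult_le_compat_l; [apply pow_le; lra|].
      rewrite <- (pow1 (k - l)); apply pow_incr; lra. }
    pose proof (Pn n ltac:(lia)); pose proof (Pn m ltac:(lia)).
    assert (Hu0 : 0 < u) by (unfold u; lra).
    apply (Rmult_le_compat_l u) in A; [| lra].
    replace (u * ((r ^ n + r ^ m) / u)) with (r ^ n + r ^ m) in A by (field; lra).
    lra. }
  assert (Hl2 : exp (2 * lam) = INR l * INR l).
  { replace (2 * lam) with (lam + lam) by ring; unfold lam; rewrite exp_plus, exp_ln by lra; ring. }
  assert (Hg0 : 0 < g).
  { unfold g; apply Rmult_lt_0_compat; [lra | apply pow_lt, Rdiv_lt_0_compat; lra]. }
  assert (Hkey : lam * lam * g <= 1 / 2).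
  { assert (E1 : INR l * INR l <= exp (INR l * u)).
    { rewrite <- Hl2; left; now apply exp_increasing. }
    rewrite exp_Ropp in Hexp.
    set (X := exp (INR l * u)) in *.
    assert (X0 : 0 < X) by apply exp_pos.
    apply (Rmult_le_compat_r X) in Hexp; [| lra].
    rewrite Rmult_assoc, (Rmult_assoc 2), Rinv_l, Rmult_1_r in Hexp by lra.
    assert (Hlu : 4 * (lam * lam) <= (INR l * u) * (INR l * u)) by nra.
    assert (E2 : (INR l * u) * (INR l * u) * g <= u * u * (g * X)).
    { replace (INR l * u * (INR l * u) * g) with (u * u * g * (INR l * INR l)) by ring.
      replace (u * u * (g * X)) with (u * u * g * X) by ring.
      apply Rmult_le_compat_l; auto; apply Rmult_le_pos; [nra | lra]. }
    assert (4 * (lam * lam) * g <= INR l * u * (INR l * u) * g)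
      by (apply Rmult_le_compat_r; lra).
    lra. }
  assert (HgE : g * ((2 + r) * (2 + r)) = (1 + r) * ((2 - r) * (2 - r))).
  { unfold g; field; lra. }
  (* For [l >= 5] the bound [ln l >= 3/2] contradicts [g > 2/9], the value of [g] at [r = 1]. For
     [l = 3, 4] only [ln l >= 1] is used, but then [r < 1/3], where [g > 1/2]. *)
  destruct (Nat.le_gt_cases 5 l) as [H5 | H5].
  - assert (Hlam5 : 3 / 2 <= lam).
    { apply Rle_trans with (1 := ln_5_lower); apply ln_le; [lra|].
      apply (le_INR 5) in H5; simpl in H5; lra. }
    assert (9 / 4 <= lam * lam) by nra.
    assert (9 / 4 * g <= lam * lam * g) by (apply Rmult_le_compat_r; lra).
    assert (g <= 2 / 9) by lra.
    assert (g * ((2 + r) * (2 + r)) <= 2 / 9 * ((2 + r) * (2 + r)))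
      by (apply Rmult_le_compat_r; nra).
    (* The product equals [9 (1 + r) (2 - r)^2 - 2 (2 + r)^2], so its sign says [g > 2/9]. *)
    assert (0 < (1 - r) * (28 + 20 * r - 9 * r * r)) by (apply Rmult_lt_0_compat; nra).
    nra.
  - assert (Hr3 : r < 1 / 3).
    { apply Rlt_le_trans with (1 := Hlt).
      assert (C : l = 3%nat \/ l = 4%nat) by lia; unfold lam; destruct C as [-> | ->].
      - replace (INR 3) with 3 by (simpl; ring); pose proof ln_3_lower; lra.
      - replace (INR 4) with (2 * 2) by (simpl; ring); rewrite ln_mult by lra.
        pose proof ln_2_lower; lra. }
    assert (1 <= lam * lam) by nra.
    assert (1 * g <= lam * lam * g) by (apply Rmult_le_compat_r; lra).
    assert (g <= 1 / 2) by lra.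
    assert (g * ((2 + r) * (2 + r)) <= 1 / 2 * ((2 + r) * (2 + r)))
      by (apply Rmult_le_compat_r; nra).
    nra.
Qed.

Theorem theorem3 (alpha : R) (a b : nat -> Cx) (n m : nat) (rnm : R) :
  0 <= alpha < 1 ->
  in_F alpha a b ->
  (2 <= n)%nat -> (2 <= m)%nat ->
  smallest_zero_psi n m alpha rnm ->
  (forall theta : R, univalent_in_disk (s_poly a b n m theta) rnm) /\
  (alpha = 1/2 -> (3 <= Nat.min n m)%nat ->
     1 - 2 * ln (INR (Nat.min n m)) / INR (Nat.min n m) <= rnm).
Proof.
  intros Ha HF Hn Hm [Hr [Hpsi _]]; split.
  - intros theta; now apply sections_univalent with alpha.
  - intros -> Hl; now apply radius_half.
Qed.
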